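(* Let $\mathcal{P}$ be a PTRS, $s\in\{\mathbf{f},\mathbf{i}\}$, and $\Sigma'$ an arbitrary signature. Then $\mathtt{AST}(\xrightarrow{s}_{\mathcal{P}})$ holds over $\Sigma^{\mathcal{P}}$ if and only if it holds over $\Sigma^{\mathcal{P}}\cup\Sigma'$; and $\mathtt{SAST}(\xrightarrow{s}_{\mathcal{P}})$ holds over $\Sigma^{\mathcal{P}}$ if and only if it holds over $\Sigma^{\mathcal{P}}\cup\Sigma'$.
   Context: $\Sigma^{\mathcal{P}}$ is the set of function symbols occurring in the rules of $\mathcal{P}$; a property ''holds over $\Sigma$'' means it holds when terms range over $\mathcal{T}(\Sigma,\mathcal{V})$ for a countable variable set $\mathcal{V}$. $\mathrm{FDist}(A)$: finite multisets of pairs $(p:a)$, $0<p\le1$, probabilities summing to 1. A PTRS is a countable set of rules $\ell\to\mu$, $\ell$ non-variable, $\mu$ a finite multi-distribution on terms, variables of terms in $\mu$ among those of $\ell$. $t\xrightarrow{\mathbf{f}}_{\mathcal{P}}\{p_1:t_1,\dots,p_k:t_k\}$ iff $t|_\pi=\ell\sigma$, $t_j=t[r_j\sigma]_\pi$ for a position $\pi$, rule $\ell\to\{p_1:r_1,\dots,p_k:r_k\}$, substitution $\sigma$; innermost ($\xrightarrow{\mathbf{i}}_{\mathcal{P}}$) if all proper subterms of $\ell\sigma$ are normal forms. Lifting $\rightrightarrows$ of $\to$: smallest relation on multi-distributions with $\{1:t\}\rightrightarrows\{1:t\}$ for normal forms, $\{1:t\}\rightrightarrows\mu$ if $t\to\mu$,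 closed under $\bigcup_jp_j\cdot\mu_j\rightrightarrows\bigcup_jp_j\cdot\nu_j$ ($\sum p_j=1$). $|\mu|_\to$: probability of normal forms; $\mathtt{AST}(\to)$: every infinite $\rightrightarrows$-sequence has $\lim|\mu_n|_\to=1$. $\mathrm{edl}((\mu_n))=\sum_n(1-|\mu_n|_\to)$; $\mathtt{SAST}(\to)$: for every term $t$, the supremum of $\mathrm{edl}$ over infinite $\rightrightarrows$-sequences with $\mu_0=\{1:t\}$ is finite. *)

(* Defs.v *)
From HB Require Import structures.
From mathcomp Require Import all_boot all_order all_algebra.
From mathcomp Require Import all_classical all_reals all_analysis.

Set Implicit Arguments.
Unset Strict Implicit.
Unset Printing Implicit Defensive.

Import Order.TTheory GRing.Theory Num.Theory.
Import numFieldNormedType.Exports.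

Local Open Scope classical_set_scope.
Local Open Scope ring_scope.

(* [F] is an ambient collection of function symbols with arities [ar]; a
   signature is a subset of [F].  The countable variable set is [nat]. *)
Inductive term (F : Type) (ar : F -> nat) : Type :=
| Var of nat
| App (f : F) of ('I_(ar f) -> term ar).

Arguments Var {F ar} _.
Arguments App {F ar} f _.

HB.instance Definition _ (F : Type) (ar : F -> nat) := gen_eqMixin (term ar).
HB.instance Definition _ (F : Type) (ar : F -> nat) :=
  gen_choiceMixin (term ar).

Section Terms.
Context {F : Type} {ar : F -> nat}.
Implicit Types (t u : term ar).

Definition is_var t : bool := if t is Var _ then true else false.

Fixpoint vars t : set nat :=
  match t with
  | Var x => [set x]
  | App f ts => [set x | exists i, vars (ts i) x]
  end.

Fixpoint syms t : set F :=
  match t with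
  | Var _ => set0
  | App f ts => [set g | g = f \/ exists i, syms (ts i) g]
  end.

(* T(S, V) *)
Definition terms_over (S : set F) : set (term ar) := [set t | syms t `<=` S].

Fixpoint subst (sigma : nat -> term ar) t : term ar :=
  match t with
  | Var x => sigma x
  | App f ts => App f (fun i => subst sigma (ts i))
  end.

(* Positions are sequences of argument indices, counted from 0;
   [subterm_at t pi] is [None] when [pi] is not a position of [t]. *)
Fixpoint subterm_at t (pi : seq nat) {struct t} : option (term ar) :=
  match pi, t with
  | [::], _ => Some t
  | i :: pi', App f ts =>
      if insub i is Some j then subterm_at (ts j) pi' else None
  | _ :: _, Var _ => None
  end.

Fixpoint replace_at t (pi : seq nat) u {struct t} : term ar :=
  match pi, t with
  | [::], _ => u
  | i :: pi', App f ts =>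
      App f (fun j => if val j == i then replace_at (ts j) pi' u else ts j)
  | _ :: _, Var _ => t
  end.

Definition proper_subterm u t : Prop :=
  exists2 pi, pi <> [::] & subterm_at t pi = Some u.

End Terms.

(* A finite multiset of pairs [(p : a)] is represented by a sequence, to be read
   up to [perm_eq]; accordingly [lifting] below is closed under permutation. *)
Definition multidist (R : realType) (A : Type) : Type := seq (R * A).

Section Lifting.
Context {R : realType} {A : eqType}.
Implicit Types (mu nu : multidist R A) (D : set A) (to : A -> multidist R A -> Prop).

Definition FDist D : set (multidist R A) :=
  [set mu | [/\ forall x, x \in mu -> 0 < x.1 <= 1,
                \sum_(x <- mu) x.1 = 1 &
                forall x, x \in mu -> D x.2]].

Definition mscale (p : R) mu : multidist R A := [seq (p * x.1, x.2) | x <- mu].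

Definition munion k (p : 'I_k -> R) (mu : 'I_k -> multidist R A) : multidist R A :=
  \big[cat/[::]]_(j < k) mscale (p j) (mu j).

Definition normal_form to (a : A) : Prop := ~ exists mu, to a mu.

Inductive lifting to : multidist R A -> multidist R A -> Prop :=
| lifting_nf a : normal_form to a -> lifting to [:: (1, a)] [:: (1, a)]
| lifting_step a mu : to a mu -> lifting to [:: (1, a)] mu
| lifting_union k (p : 'I_k -> R) (mu nu : 'I_k -> multidist R A) :
    (forall j, 0 < p j) -> \sum_(j < k) p j = 1 ->
    (forall j, lifting to (mu j) (nu j)) ->
    lifting to (munion p mu) (munion p nu)
| lifting_perm mu mu' nu nu' :
    perm_eq mu mu' -> perm_eq nu nu' -> lifting to mu nu -> lifting to mu' nu'.

Definition nf_prob to mu : R := \sum_(x <- mu | `[< normal_form to x.2 >]) x.1.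

(* [D] is the set the objects range over: here [to] is a relation on all terms
   and [D] is the set of terms over a given signature. *)
Definition lifting_seq D to (mu : nat -> multidist R A) : Prop :=
  (forall n, FDist D (mu n)) /\ (forall n, lifting to (mu n) (mu n.+1)).

Definition edl to (mu : nat -> multidist R A) : \bar R :=
  (\sum_(0 <= n <oo) (1 - nf_prob to (mu n))%:E)%E.

Definition AST D to : Prop :=
  forall mu : nat -> multidist R A,
    lifting_seq D to mu -> nf_prob to (mu n) @[n --> \oo] --> (1 : R).

Definition SAST D to : Prop :=
  forall a, D a ->
    (ereal_sup [set edl to mu | mu in
       [set mu : nat -> multidist R A | lifting_seq D to mu /\ mu 0%N = [:: (1%R, a)]]] < +oo)%E.

End Lifting.

Definition rule (R : realType) (F : Type) (ar : F -> nat) : Type :=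
  (term ar * multidist R (term ar))%type.

Variant strategy := full | innermost.

Section PTRS.
Context {R : realType} {F : Type} {ar : F -> nat}.
Implicit Types (P : set (rule R ar)) (t : term ar).

Definition is_PTRS P : Prop :=
  countable P /\
  forall l mu, P (l, mu) ->
    [/\ ~~ is_var l,
        FDist setT mu &
        forall x, x \in mu -> vars x.2 `<=` vars l].

Definition sig_of P : set F :=
  [set g | exists l mu, P (l, mu) /\
     (syms l g \/ exists2 x, x \in mu & syms x.2 g)].

Definition rewrite_with (ok : set (term ar)) P t
    (nu : multidist R (term ar)) : Prop :=
  exists pi l mu sigma,
    [/\ P (l, mu),
        subterm_at t pi = Some (subst sigma l),
        ok (subst sigma l) &
        nu = [seq (x.1, replace_at t pi (subst sigma x.2)) | x <- mu]].

Definition full_step P := rewrite_with setT P.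

Definition innermost_step P :=
  rewrite_with
    [set r | forall u, proper_subterm u r -> normal_form (full_step P) u] P.

Definition step (s : strategy) P :=
  match s with full => full_step P | innermost => innermost_step P end.

End PTRS.

(* Main.v *)
Require Import Defs.
From HB Require Import structures.
From mathcomp Require Import all_boot all_order all_algebra.
From mathcomp Require Import all_classical all_reals all_analysis.
From mathcomp Require Import lra.
From Stdlib Require Eqdep_dec.
(* Imported again because measure theory has its own [mscale]. *)
Import Defs.

(** Both properties are first turned into statements about single terms.
    [AST] over a set closed under steps means that the greatest fixpoint [v] of
    [v t = sup_{t -> mu} E_mu v] with values in [[0, 1]] and [v = 0] on normal
    forms vanishes there; [SAST] means that there is a finite potential [W] with
    [1 + E_mu W <= W t] for every step [t -> mu].

    For full rewriting, if some symbol [c] of the rules has arity at least 2, a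
    term [g(t1, .., tn)] with [g] foreign to the rules is encoded by
    [c(t1, c(t2, ..))]; this preserves all steps.

    Otherwise the rewriting is innermost, or all symbols of the rules have arity
    at most 1.  A term is then a skeleton [u] over the symbols of the rules
    whose variables stand for leaves [b], namely variables and terms with a
    foreign root.  Each step is a step of one leaf, or a step of [u] that
    remains valid whenever the leaves are replaced by variables in such a way
    that two normal leaves get the same variable exactly when they are equal.
    So the term runs as a product of a skeleton over the symbols of the rules
    and of its leaves, and the leaves are handled by structural induction.
    Since the leaves not yet in normal form may later become equal or stay
    distinct, the potential is the sum, over all compatible identifications of
    the variables, of the potentials of the skeletons, plus the potentials of
    the leaves. *)

Set Implicit Arguments.
Unset Strict Implicit.
Unset Printing Implicit Defensive.

Import Order.TTheory GRing.Theory Num.Theory.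
Import numFieldNormedType.Exports.

Local Open Scope classical_set_scope.
Local Open Scope ring_scope.

(** * Expectations of real functions under finite multi-distributions *)

Section Expectation.
Context {R : realType}.

Definition Ex {J : Type} (mu : multidist R J) (w : J -> R) : R :=
  \sum_(x <- mu) x.1 * w x.2.

Definition mmap {J K : Type} (h : J -> K) (mu : multidist R J) : multidist R K :=
  [seq (x.1, h x.2) | x <- mu].

Lemma Ex_mmap (J K : Type) (h : J -> K) mu (w : K -> R) :
  Ex (mmap h mu) w = Ex mu (w \o h).
Proof. by rewrite /Ex big_map. Qed.

Lemma Ex_mscale (J : eqType) p (mu : multidist R J) w :
  Ex (mscale p mu) w = p * Ex mu w.
Proof.
by rewrite /Ex big_map big_distrr; apply: eq_bigr => x _ /=; rewrite mulrA.
Qed.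

Lemma Ex_cat (J : Type) (mu nu : multidist R J) w :
  Ex (mu ++ nu) w = Ex mu w + Ex nu w.
Proof. by rewrite /Ex big_cat. Qed.

Lemma mmap_comp (J K L : Type) (h : J -> K) (g : K -> L) mu :
  mmap g (mmap h mu) = mmap (g \o h) mu.
Proof. by rewrite /mmap -map_comp. Qed.

Lemma eq_in_mmap (J : eqType) (K : Type) (h g : J -> K) mu :
  (forall x, x \in mu -> h x.2 = g x.2) -> mmap h mu = mmap g mu.
Proof. by move=> hg; apply/eq_in_map => x /hg ->. Qed.

Lemma mem_mmap (J K : eqType) (h : J -> K) mu x :
  x \in mmap h mu -> exists2 y, y \in mu & x = (y.1, h y.2).
Proof. by move=> /mapP. Qed.

Lemma FDist_mmap (J K : eqType) (h : J -> K) (mu : multidist R J) :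
  FDist setT (mmap h mu) -> FDist setT mu.
Proof.
move=> [h1 h2 _]; split=> //; last by rewrite big_map in h2.
by move=> x xmu; apply: (h1 (x.1, h x.2)); apply/mapP; exists x.
Qed.

Lemma mmap_FDist (J K : eqType) (h : J -> K) (mu : multidist R J) :
  FDist setT mu -> FDist setT (mmap h mu).
Proof.
move=> [h1 h2 _]; split=> //; last by rewrite big_map.
by move=> x /mem_mmap[y ymu ->]; apply: (h1 _ ymu).
Qed.

Lemma ler_Ex (J : eqType) (mu : multidist R J) (v w : J -> R) :
  (forall x, x \in mu -> 0 <= x.1) -> (forall x, x \in mu -> v x.2 <= w x.2) ->
  Ex mu v <= Ex mu w.
Proof.
move=> p0 vw; rewrite /Ex !big_seq; apply: ler_sum => x xmu.
by rewrite ler_wpM2l ?p0 ?vw.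
Qed.

Lemma Ex_ge0 (J : eqType) (mu : multidist R J) (w : J -> R) :
  (forall x, x \in mu -> 0 <= x.1) -> (forall x, x \in mu -> 0 <= w x.2) ->
  0 <= Ex mu w.
Proof.
by move=> p0 w0; rewrite /Ex big_seq; apply: sumr_ge0 => x xmu; rewrite mulr_ge0 ?p0 ?w0.
Qed.

Lemma Ex_addr (J : Type) (mu : multidist R J) (v w : J -> R) :
  Ex mu (fun a => v a + w a) = Ex mu v + Ex mu w.
Proof. by rewrite /Ex -big_split; apply: eq_bigr => x _; rewrite mulrDr. Qed.

Lemma Ex_sum (J : Type) (I : finType) (C : pred I) (mu : multidist R J) (w : I -> J -> R) :
  Ex mu (fun a => \sum_(i | C i) w i a) = \sum_(i | C i) Ex mu (w i).
Proof. by rewrite /Ex exchange_big; apply: eq_bigr => x _; rewrite mulr_sumr. Qed.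

Lemma Ex_cst (J : eqType) (mu : multidist R J) (c : R) :
  FDist setT mu -> Ex mu (fun=> c) = c.
Proof. by case=> _ h _; rewrite /Ex -mulr_suml h mul1r. Qed.

Lemma FDist_ge0 (J : eqType) D (mu : multidist R J) :
  FDist D mu -> forall x, x \in mu -> 0 <= x.1.
Proof. by move=> [h _ _] x /h /andP[/ltW]. Qed.

Lemma Ex01 (J : eqType) (mu : multidist R J) w : FDist setT mu ->
  (forall a, 0 <= w a <= 1) -> 0 <= Ex mu w <= 1.
Proof.
move=> dmu w01; rewrite Ex_ge0 /=; first last.
- by move=> x _; case/andP: (w01 x.2).
- exact: FDist_ge0 dmu.
rewrite -[leRHS](Ex_cst _ dmu); apply: ler_Ex; first exact: FDist_ge0 dmu.
by move=> x _; case/andP: (w01 x.2).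
Qed.

Lemma sup01 (S : set R) : S !=set0 -> (forall x, S x -> 0 <= x <= 1) ->
  [/\ 0 <= sup S <= 1, (forall x, S x -> x <= sup S) &
   forall e, 0 < e -> exists2 x, S x & sup S < x + e].
Proof.
move=> S0 S01.
have ub : has_ubound S by exists 1 => x /S01 /andP[].
have le x : S x -> x <= sup S by move=> Sx; apply: ub_le_sup.
split => //.
  have [x Sx] := S0; have /andP[x0 _] := S01 _ Sx.
  rewrite (le_trans x0 (le _ Sx)) /=; apply: ge_sup => // y /S01 /andP[]//.
move=> e e0; have [x Sx] := sup_adherent e0 (conj S0 ub); exists x => //; lra.
Qed.

End Expectation.

(** * Fixpoint certificates for single objects *)

Section Certificates.
Context {R : realType} {A : eqType}.
Variable to : A -> multidist R A -> Prop.
Hypothesis to_FDist : forall a mu, to a mu -> FDist setT mu.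

(** The slack [e] is needed because the supremum over the possibly infinitely many steps of [a] need
    not be attained. A positive value demands a step, so [v] vanishes on normal forms. *)
Definition postfixpoint (v : A -> R) : Prop :=
  (forall a, 0 <= v a <= 1) /\
  (forall a, 0 < v a -> forall e, 0 < e ->
     exists2 mu, to a mu & v a <= Ex mu v + e).

Definition ast_at (a : A) : Prop := forall v, postfixpoint v -> v a <= 0.

(** [W] is a ranking supermartingale. The step-closed set [E] is where it is meaningful, which lets
    [W] be real-valued instead of taking the value infinity elsewhere. *)
Definition prefixpoint (E : set A) (W : A -> R) : Prop :=
  forall a, E a -> 0 <= W a /\
    forall mu, to a mu -> (forall x, x \in mu -> E x.2) /\ 1 + Ex mu W <= W a.

Definition sast_at (a : A) : Prop := exists E W, prefixpoint E W /\ E a.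

Definition cost (a : A) : R :=
  inf [set c | exists E W, [/\ prefixpoint E W, E a & c = W a]].

Lemma ast_at_nf a : normal_form to a -> ast_at a.
Proof.
move=> nfa v [v01 vp]; rewrite leNgt; apply/negP => va0.
by have [mu tamu _] := vp _ va0 _ ltr01; apply: nfa; exists mu.
Qed.

(** Raising [v] at [a] to at least [Ex mu v] keeps it a postfixpoint, as expectations only grow and
    [mu] itself witnesses the new value. A positive [v x.2] would thus give a positive value at
    [a]. *)
Lemma ast_at_step a mu x : ast_at a -> to a mu -> x \in mu -> ast_at x.2.
Proof.
move=> Na tamu xmu v [v01 vp]; rewrite leNgt; apply/negP => vx0.
have [p01 s1 _] := to_FDist tamu.
have p0 := FDist_ge0 (to_FDist tamu).
pose v' b := if b == a then Num.max (v a) (Ex mu v) else v b.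
have vv' b : v b <= v' b by rewrite /v'; case: eqP => // ->; rewrite le_max lexx.
have Ev0 : 0 < Ex mu v.
  apply: lt_le_trans (_ : x.1 * v x.2 <= _).
    by rewrite mulr_gt0 //; case/andP: (p01 _ xmu).
  rewrite /Ex (big_rem x xmu) /= lerDl big_seq sumr_ge0 // => y /mem_rem ymu.
  by rewrite mulr_ge0 ?p0 //; case/andP: (v01 y.2).
have Ev1 : Ex mu v <= 1.
  rewrite -(Ex_cst 1 (to_FDist tamu)); apply: ler_Ex => // y _.
  by case/andP: (v01 y.2).
have Evv' nu b : to b nu -> Ex nu v <= Ex nu v'.
  by move=> tb; apply: ler_Ex => // y ymu; apply: FDist_ge0 (to_FDist tb) _ ymu.
have H : postfixpoint v' -> Num.max (v a) (Ex mu v) <= 0.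
  by move=> /Na; rewrite /v' eqxx.
have : Num.max (v a) (Ex mu v) <= 0; last first.
  by rewrite ge_max => /andP[_]; rewrite leNgt Ev0.
apply: H; split.
  move=> b; rewrite /v'; case: eqP => // _.
  by rewrite le_max (ltW Ev0) orbT ge_max Ev1; case/andP: (v01 a) => _ ->.
move=> b v'b0 e e0; have [ba|ba] := eqVneq b a; last first.
  rewrite /v' (negbTE ba) in v'b0 *.
  have [nu tb le] := vp _ v'b0 _ e0; exists nu => //.
  by apply: le_trans le _; rewrite lerD2r; apply: Evv' tb.
have -> : v' b = Num.max (v a) (Ex mu v) by rewrite ba /v' eqxx.
rewrite ba.
have [le|lt] := leP (v a) (Ex mu v).
  exists mu => //; apply: le_trans (Evv' _ _ tamu) _; lra.
have va0 : 0 < v a by lra.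
have [nu tb le'] := vp _ va0 _ e0; exists nu => //.
by apply: le_trans le' _; rewrite lerD2r; apply: Evv' tb.
Qed.

(** Each potential defined at [a] also bounds [cost] at the successors of [a], so the pointwise
    infimum inherits the inequality. This yields one canonical potential for all objects at once. *)
Lemma prefixpoint_cost : prefixpoint sast_at cost.
Proof.
have lb a : has_lbound [set c | exists E W, [/\ prefixpoint E W, E a & c = W a]].
  by exists 0 => _ [E [W [/(_ a) pEW Ea ->]]]; have [] := pEW Ea.
have le_cost E W a : prefixpoint E W -> E a -> cost a <= W a.
  by move=> pEW Ea; apply: ge_inf => //; exists E, W.
have ne a : sast_at a -> [set c | exists E W, [/\ prefixpoint E W, E a & c = W a]] !=set0.
  by move=> [E [W [pEW Ea]]]; exists (W a), E, W.
move=> a sa; split.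
  apply: lb_le_inf; first exact: ne.
  by move=> _ [E [W [/(_ a) pEW Ea ->]]]; have [] := pEW Ea.
move=> mu tamu; split.
  move=> x xmu; have [E [W [pEW Ea]]] := sa; exists E, W; split => //.
  by have [_ /(_ _ tamu)[h _]] := pEW _ Ea; apply: h.
apply: lb_le_inf; first exact: ne.
move=> _ [E [W [pEW Ea ->]]]; have [_ /(_ _ tamu)[h le]] := pEW _ Ea.
apply: le_trans le; rewrite lerD2l; apply: ler_Ex; first exact: FDist_ge0 (to_FDist tamu).
by move=> x xmu; apply: (le_cost E) => //; apply: h.
Qed.

(* The potential lives on states representing the objects, and an object may
   have several representing states. *)
Lemma sast_at_potential (S : Type) (tm : S -> A) (G : S -> Prop) (Phi : S -> R) :
  (forall s, G s -> 0 <= Phi s) ->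
  (forall s mu, G s -> to (tm s) mu ->
     exists (J : eqType) (nu : multidist R J) (h : J -> S),
       [/\ mu = mmap (tm \o h) nu, forall x, x \in nu -> G (h x.2) &
           1 + Ex nu (Phi \o h) <= Phi s]) ->
  forall s, G s -> sast_at (tm s).
Proof.
move=> Phi0 step s Gs.
pose W a := inf [set c | exists s, [/\ G s, tm s = a & c = Phi s]].
exists [set a | exists2 s, G s & tm s = a], W; split; last by exists s.
have lb a : has_lbound [set c | exists s, [/\ G s, tm s = a & c = Phi s]].
  by exists 0 => _ [s' [/Phi0 ? _ ->]].
move=> _ [{}s {}Gs <-]; split.
  by apply: lb_le_inf => [|_ [s' [/Phi0 ? _ ->//]]]; exists (Phi s), s.
move=> mu tmu; split.
  have [J [nu [h [-> Gh _]]]] := step _ _ Gs tmu.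
  by move=> x /mem_mmap[y ynu ->] /=; exists (h y.2) => //; apply: Gh.
apply: lb_le_inf; first by exists (Phi s), s.
move=> _ [s' [Gs' e ->]]; rewrite -e in tmu.
have [J [nu [h [emu Gh le]]]] := step _ _ Gs' tmu.
apply: le_trans le; rewrite lerD2l.
rewrite emu Ex_mmap; apply: ler_Ex.
  by apply: (FDist_ge0 (D := setT)); apply: (FDist_mmap (h := tm \o h)); rewrite -emu; apply: to_FDist tmu.
by move=> x xnu /=; apply: ge_inf => //; exists (h x.2); split => //; apply: Gh.
Qed.

End Certificates.

(** * Products of independent components *)

Definition upd {A : Type} (b : nat -> A) (z : nat) (a : A) (n : nat) : A :=
  if n == z then a else b n.

Section Product.
Context {R : realType} {A : eqType}.
Variable to : A -> multidist R A -> Prop.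
Hypothesis to_FDist : forall a mu, to a mu -> FDist setT mu.

(* A state consists of a skeleton [u : U] and of components [b], only the first
   [m] of which matter; [tm u b] is the object it represents.  Each [phi th]
   with [C b th] simulates the inner steps, which do not touch the components. *)
Variables (U : eqType) (Theta : finType) (m : nat).
Variables (tm : U -> (nat -> A) -> A) (good : U -> (nat -> A) -> Prop).
Variables (C : (nat -> A) -> pred Theta) (phi : Theta -> U -> A).

Definition inner_step b u (mu : multidist R U) : Prop :=
  forall th, C b th -> to (phi th u) (mmap (phi th) mu).

Hypothesis C_nonempty : forall b, exists th, C b th.
(** The set of compatible [th] can only shrink when a component moves, so a sum over it of
    nonnegative terms does not grow. *)
Hypothesis C_step : forall b z mu x th,
  to (b z) mu -> x \in mu -> C (upd b z x.2) th -> C b th.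
Hypothesis good_outer : forall b u z mu x, good u b -> to (b z) mu ->
  x \in mu -> good u (upd b z x.2).
Hypothesis decompose : forall u b mu, good u b -> to (tm u b) mu ->
  (exists nu, [/\ inner_step b u nu, forall x, x \in nu -> good x.2 b &
     mu = mmap (tm^~ b) nu]) \/
  (exists z nu, [/\ (z < m)%N, to (b z) nu & mu = mmap (fun a => tm u (upd b z a)) nu]).

Lemma sast_product u b : (forall th u b, good u b -> sast_at to (phi th u)) ->
  good u b -> (forall z, sast_at to (b z)) -> sast_at to (tm u b).
Proof.
move=> sphi gub sb.
have [c0 cstep] : (forall a, sast_at to a -> 0 <= cost to a) /\
   forall a mu, sast_at to a -> to a mu -> (forall x, x \in mu -> sast_at to x.2)
     /\ 1 + Ex mu (cost to) <= cost to a.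
  by split=> [a|a mu] /(prefixpoint_cost to_FDist)[] // _; apply.
pose Phi (s : U * (nat -> A)) : R :=
  \sum_(th | C s.2 th) cost to (phi th s.1) + \sum_(i < m) cost to (s.2 i).
pose G (s : U * (nat -> A)) := good s.1 s.2 /\ forall z, sast_at to (s.2 z).
apply: (@sast_at_potential _ _ _ to_FDist _ (fun s : U * (nat -> A) => tm s.1 s.2)
   G Phi _ _ (u, b)); last by split.
  move=> [{}u {}b] [/= {}gub {}sb]; apply: addr_ge0; apply: sumr_ge0 => i _; apply: c0 => //.
  exact: sphi gub.
move=> {u b gub sb} [u b] mu [/= gub sb] tmu.
case: (decompose gub tmu) => [[nu [inu gnu emu]]|[z [nu [zm bz emu]]]].
  exists U, nu, (fun u => (u, b)); split => //.
    by move=> x xnu; split => //=; apply: gnu.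
  rewrite /Phi /= /comp /= Ex_addr Ex_sum.
  have [th0 Cth0] := C_nonempty b.
  have dnu : FDist setT nu by apply: FDist_mmap (to_FDist (inu _ Cth0)).
  rewrite (Ex_cst _ dnu) addrA lerD2r.
  have le th : C b th -> 1 + Ex nu (fun u => cost to (phi th u)) <= cost to (phi th u).
    move=> Cth; have [_] := cstep _ _ (sphi th _ _ gub) (inu _ Cth).
    by rewrite Ex_mmap.
  (* An inner step is simulated by every compatible [th]; a single one, [th0], supplies the required
     decrease by 1. *)
  rewrite (bigD1 th0) //= [leRHS](bigD1 th0) //= addrA; apply: lerD; first exact: le.
  by apply: ler_sum => th /andP[/le]; lra.
exists A, nu, (fun a => (u, upd b z a)); split => //.
  move=> x xnu; split => /=; first exact: good_outer gub bz xnu.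
  move=> n; rewrite /upd; case: eqP => // _.
  by have [+ _] := cstep _ _ (sb z) bz; apply.
(* For a component step the sum over [th] does not grow, and the cost of component [z] pays the
   1. *)
rewrite /Phi /comp /= Ex_addr addrCA; apply: lerD.
  rewrite -[leRHS](Ex_cst _ (to_FDist bz)); apply: ler_Ex; first exact: FDist_ge0 (to_FDist bz).
  move=> x xnu; rewrite [leLHS]big_mkcond [leRHS]big_mkcond.
  apply: ler_sum => th _; case: ifP => [/(C_step bz xnu) ->//|_].
  by case: ifP => // _; apply: c0; apply: sphi gub.
rewrite (Ex_sum xpredT) (bigD1 (Ordinal zm)) //= [leRHS](bigD1 (Ordinal zm)) //=.
rewrite addrA; apply: lerD.
  have [_ +] := cstep _ _ (sb z) bz; congr (1 + Ex nu _ <= _).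
  by apply/funext => a; rewrite /upd eqxx.
apply: ler_sum => i /negbTE iz; rewrite -[leRHS](Ex_cst _ (to_FDist bz)).
by apply: ler_Ex => [|x xnu]; [exact: FDist_ge0 (to_FDist bz)|rewrite /upd -[z]/(val (Ordinal zm)) val_eqE iz].
Qed.

(* The adversary may use inner steps and steps of the first [k] components. *)
Definition local_postfixpoint k (w : U -> (nat -> A) -> R) : Prop :=
  (forall u b, 0 <= w u b <= 1) /\
  forall u b, good u b -> (forall z, ast_at to (b z)) -> 0 < w u b ->
  forall e, 0 < e ->
  (exists mu, [/\ inner_step b u mu, forall x, x \in mu -> good x.2 b &
      w u b <= Ex mu (w^~ b) + e]) \/
  (exists z mu, [/\ (z < k)%N, to (b z) mu & w u b <= Ex mu (fun a => w u (upd b z a)) + e]).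

(** Induction on the number [k] of components that may move. With none, the skeleton alone must keep
    up [w], against [sphi]; an additional component is removed by comparing [w] with what is left
    after its next step. *)
Lemma local_postfixpoint0 k w u b :
  (forall th u b, good u b -> ast_at to (phi th u)) ->
  local_postfixpoint k w -> good u b -> (forall z, ast_at to (b z)) -> w u b <= 0.
Proof.
move=> sphi.
elim: k w u b => [|k IH] w u b [w01 wp] gub sb.
  have [th Cth] := C_nonempty b.
  (* The components are frozen, so one compatible [th] suffices: the best value of [w] over the good
     skeletons with image [a] is a postfixpoint of [to]. The value 0 only keeps the set nonempty. *)
  pose S a := [set r | r = 0 \/ exists u, [/\ good u b, phi th u = a & r = w u b]].
  have S0 a : S a !=set0 by exists 0; left.
  have S01 a r : S a r -> 0 <= r <= 1.
    by move=> [->|[u' [_ _ ->]]]; rewrite ?lexx ?ler01.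
  pose v a := sup (S a).
  have pv : postfixpoint to v.
    split=> [a|a va0 e e0]; first by case: (sup01 (S0 a) (@S01 a)).
    have [_ _ ad] := sup01 (S0 a) (@S01 a).
    (* The bound [v a] makes [r] positive and so excludes the artificial 0; [e / 2] leaves the other
       half of [e] for the step taken from [w]. *)
    have [|r Sr ltr] := ad (Num.min (e / 2) (v a)).
      by rewrite lt_min va0 andbT divr_gt0.
    have rv : v a < r + e / 2 by apply: lt_le_trans ltr _; rewrite lerD2l ge_min lexx.
    have r0 : 0 < r.
      have : v a < r + v a by apply: lt_le_trans ltr _; rewrite lerD2l ge_min lexx orbT.
      lra.
    case: Sr => [r00|[u' [gu' eu' er]]]; first by rewrite r00 ltxx in r0.
    rewrite er in r0; have e20 : 0 < e / 2 by rewrite divr_gt0.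
    case: (wp _ _ gu' sb r0 _ e20) => [[mu [imu gmu le]]|[z [mu []]]//].
    have tmu := imu _ Cth; exists (mmap (phi th) mu); first by rewrite -eu'.
    have : Ex mu (w^~ b) <= Ex (mmap (phi th) mu) v.
      rewrite Ex_mmap; apply: ler_Ex.
        by apply: (FDist_ge0 (D := setT)); apply: FDist_mmap (to_FDist tmu).
      move=> x xmu /=; have [_ + _] := sup01 (S0 (phi th x.2)) (@S01 (phi th x.2)).
      by apply; right; exists x.2; split => //; apply: gmu.
    by move: rv le; rewrite er; lra.
  have := sphi th _ _ gub _ pv; apply: le_trans.
  have [_ + _] := sup01 (S0 (phi th u)) (@S01 (phi th u)).
  by apply; right; exists u.
(* [M a] is the best value right after a step of component [k] at [a].  The
   excess of [w] over [M] can only be kept up by the other components, hence it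
   vanishes; then the supremum of [w] over all states in which component [k] is
   [a] is a postfixpoint in [a]. *)
have Ex_upd01 mu u' b' z' a : to a mu -> 0 <= Ex mu (fun x => w u' (upd b' z' x)) <= 1.
  by move=> ta; apply: Ex01 => //; apply: to_FDist ta.
pose S a := [set r | r = 0 \/ exists u b mu, [/\ good u b, forall z, ast_at to (b z), b k = a,
  to a mu & r = Ex mu (fun x => w u (upd b k x))]].
have S0 a : S a !=set0 by exists 0; left.
have S01 a r : S a r -> 0 <= r <= 1.
  move=> [->|[u' [b' [mu [_ _ _ ta ->]]]]]; rewrite ?lexx ?ler01 //.
  exact: Ex_upd01 ta.
pose M a := sup (S a).
have M01 a : 0 <= M a <= 1 by case: (sup01 (S0 a) (@S01 a)).
pose w' u b := Num.max 0 (w u b - M (b k)).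
have wM u' b' : good u' b' -> (forall z, ast_at to (b' z)) -> w u' b' <= M (b' k).
  move=> gub' sb'; suff : w' u' b' <= 0 by rewrite ge_max lexx /= subr_le0.
  apply: IH => //; split.
    move=> u'' b''; rewrite /w' le_max lexx /= ge_max ler01 /=.
    by have := w01 u'' b''; have := M01 (b'' k); lra.
  move=> {gub' sb'} {}u' {}b' gub' sb' w'0 e e0.
  have w'E : w' u' b' = w u' b' - M (b' k).
    by move: w'0; rewrite /w' lt_max ltxx /= => /ltW/max_r.
  have le_w' u'' b'' : w u'' b'' - M (b'' k) <= w' u'' b'' by rewrite /w' le_max lexx orbT.
  have w0 : 0 < w u' b' by move: w'0; rewrite w'E; have := M01 (b' k); lra.
  (* A step of component [k] itself would give [w' u' b' <= e'], which the bound by half of the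
     positive excess rules out. *)
  pose e' := Num.min e (w' u' b' / 2).
  have e'0 : 0 < e' by rewrite lt_min e0 divr_gt0.
  have e'e : e' <= e by rewrite ge_min lexx.
  have e'w : e' <= w' u' b' / 2 by rewrite ge_min lexx orbT.
  case: (wp _ _ gub' sb' w0 _ e'0) => [[mu [imu gmu le]]|[z [mu [zk bz le]]]].
    left; exists mu; split => //.
    have [th Cth] := C_nonempty b'.
    have dmu : FDist setT mu by apply: FDist_mmap (to_FDist (imu _ Cth)).
    have : Ex mu (w^~ b') - M (b' k) <= Ex mu (w'^~ b').
      rewrite -(Ex_cst (- M (b' k)) dmu) -Ex_addr; apply: ler_Ex => //.
      exact: FDist_ge0 dmu.
    by rewrite w'E; lra.
  have dmu := to_FDist bz.
  have [zk'|zk'] := eqVneq z k.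
    have : Ex mu (fun a => w u' (upd b' z a)) <= M (b' k).
      have [_ + _] := sup01 (S0 (b' k)) (@S01 (b' k)).
      by apply; right; exists u', b', mu; rewrite -zk'; split.
    move: w'0 e'w; rewrite w'E => *; lra.
  right; exists z, mu; split => //; first by rewrite ltn_neqAle zk'.
  have : Ex mu (fun a => w u' (upd b' z a)) - M (b' k) <= Ex mu (fun a => w' u' (upd b' z a)).
    rewrite -(Ex_cst (- M (b' k)) dmu) -Ex_addr; apply: ler_Ex.
      exact: FDist_ge0 dmu.
    move=> x xmu; have := le_w' u' (upd b' z x.2).
    by rewrite {2}/upd eq_sym (negbTE zk').
  by rewrite w'E; lra.
pose S' a := [set r | r = 0 \/ exists u b, [/\ good u b, forall z, ast_at to (b z), b k = a &
  r = w u b]].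
have S'0 a : S' a !=set0 by exists 0; left.
have S'01 a r : S' a r -> 0 <= r <= 1.
  by move=> [->|[u' [b' [_ _ _ ->]]]]; rewrite ?lexx ?ler01.
pose v a := sup (S' a).
have v01 a : 0 <= v a <= 1 by case: (sup01 (S'0 a) (@S'01 a)).
have vM a : v a <= M a.
  apply: ge_sup => // r [->|[u' [b' [gub' sb' <- ->]]]]; last exact: wM.
  by case/andP: (M01 a).
have pv : postfixpoint to v.
  split=> // a va0 e e0.
  (* Since [v a <= M a], a step of component [k] that nearly attains [M a] is the witness for [v] at
     [a]. *)
  have [_ _ ad] := sup01 (S0 a) (@S01 a).
  have [|r Sr ltr] := ad (Num.min e (v a)); first by rewrite lt_min e0.
  have rv : M a < r + e by apply: lt_le_trans ltr _; rewrite lerD2l ge_min lexx.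
  have r0 : 0 < r.
    have : M a < r + v a by apply: lt_le_trans ltr _; rewrite lerD2l ge_min lexx orbT.
    by have := vM a; lra.
  case: Sr => [r00|[u' [b' [mu [gub' sb' bk ta er]]]]]; first by rewrite r00 ltxx in r0.
  exists mu => //.
  have : Ex mu (fun x => w u' (upd b' k x)) <= Ex mu v.
    apply: ler_Ex; first exact: FDist_ge0 (to_FDist ta).
    move=> x xmu; have [_ + _] := sup01 (S'0 x.2) (@S'01 x.2).
    apply; right; exists u', (upd b' k x.2); split => //.
    - by apply: good_outer gub' _ xmu; rewrite bk.
    - move=> z; rewrite /upd; case: eqP => // _.
      by apply: (ast_at_step to_FDist _ ta xmu); rewrite -bk.
    - by rewrite /upd eqxx.
  by have := vM a; lra.
have := sb k _ pv; apply: le_trans.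
have [_ + _] := sup01 (S'0 (b k)) (@S'01 (b k)).
by apply; right; exists u, b.
Qed.

Lemma ast_product u b : (forall th u b, good u b -> ast_at to (phi th u)) ->
  good u b -> (forall z, ast_at to (b z)) -> ast_at to (tm u b).
Proof.
move=> sphi gub sb v [v01 vp].
apply: (@local_postfixpoint0 m (fun u b => v (tm u b))) => //; split => //.
move=> {gub sb} {}u {}b gub sb v0 e e0.
have [mu tmu le] := vp _ v0 _ e0.
case: (decompose gub tmu) => [[nu [inu gnu emu]]|[z [nu [zm bz emu]]]].
  by left; exists nu; split => //; rewrite emu Ex_mmap in le.
by right; exists z, nu; split => //; rewrite emu Ex_mmap in le.
Qed.

End Product.

(** Abstracts what [sast_product] and [ast_product] have in common, so that the arguments about
    terms are given once for both properties. *)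
Definition product_closed (R : realType) (A : eqType) (to : A -> multidist R A -> Prop)
    (K : A -> Prop) : Prop :=
  forall (U : eqType) (Theta : finType) (m : nat)
    (tm : U -> (nat -> A) -> A) (good : U -> (nat -> A) -> Prop)
    (C : (nat -> A) -> pred Theta) (phi : Theta -> U -> A),
  (forall b, exists th, C b th) ->
  (forall b z mu x th,
     to (b z) mu -> x \in mu -> C (upd b z x.2) th -> C b th) ->
  (forall b u z mu x, good u b -> to (b z) mu -> x \in mu -> good u (upd b z x.2)) ->
  (forall u b mu, good u b -> to (tm u b) mu ->
    (exists nu, [/\ inner_step to C phi b u nu, forall x, x \in nu -> good x.2 b &
       mu = mmap (tm^~ b) nu]) \/
    (exists z nu, [/\ (z < m)%N, to (b z) nu & mu = mmap (fun a => tm u (upd b z a)) nu])) ->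
  (forall th u b, good u b -> K (phi th u)) ->
  forall u b, good u b -> (forall z, K (b z)) -> K (tm u b).

Lemma product_closed_sast_at (R : realType) (A : eqType) (to : A -> multidist R A -> Prop) :
  (forall a mu, to a mu -> FDist setT mu) -> product_closed to (sast_at to).
Proof.
move=> d U Theta m tm good C phi h1 h2 h3 h4 h5 u b gub Kb.
exact: (sast_product d h1 h2 h3 h4 h5 gub Kb).
Qed.

Lemma product_closed_ast_at (R : realType) (A : eqType) (to : A -> multidist R A -> Prop) :
  (forall a mu, to a mu -> FDist setT mu) -> product_closed to (ast_at to).
Proof.
move=> d U Theta m tm good C phi h1 h2 h3 h4 h5 u b gub Kb.
exact: (ast_product d h1 h3 h4 h5 gub Kb).
Qed.

(** * From lifting sequences to certificates and back *)

Section Sequences.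
Context {R : realType} {A : eqType}.
Variable to : A -> multidist R A -> Prop.
Hypothesis to_FDist : forall a mu, to a mu -> FDist setT mu.
Implicit Types (mu nu : multidist R A) (D : set A).

Definition nf_step a mu : Prop :=
  (normal_form to a /\ mu = [:: (1, a)]) \/ to a mu.

Lemma nf_step_FDist a mu : nf_step a mu -> FDist setT mu.
Proof.
case=> [[_ ->]|/to_FDist //]; split=> //; last by rewrite big_seq1.
by move=> x; rewrite inE => /eqP -> /=; rewrite ltr01 lexx.
Qed.

Definition step_closed D : Prop :=
  forall a mu x, D a -> to a mu -> x \in mu -> D x.2.

(* [lifting] without reordering: every item is replaced in place. *)
Inductive mlift : multidist R A -> multidist R A -> Prop :=
| mlift_nil : mlift [::] [::]
| mlift_cons p a mua mu nu :
    nf_step a mua -> mlift mu nu -> mlift ((p, a) :: mu) (mscale p mua ++ nu).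

Lemma mlift_cons_inv p a mu nu : mlift ((p, a) :: mu) nu ->
  exists mua nu', [/\ nf_step a mua, mlift mu nu' & nu = mscale p mua ++ nu'].
Proof. by move=> H; inversion H; subst; exists mua, nu0. Qed.

Lemma mlift_nil_inv nu : mlift [::] nu -> nu = [::].
Proof. by move=> H; inversion H. Qed.

Lemma mlift_cat mu1 mu2 nu1 nu2 :
  mlift mu1 nu1 -> mlift mu2 nu2 -> mlift (mu1 ++ mu2) (nu1 ++ nu2).
Proof.
move=> H1 H2; elim: H1 => // p a mua mu nu ta _ IH.
by rewrite -catA cat_cons; apply: mlift_cons.
Qed.

Lemma mlift_cat_inv mu1 mu2 nu : mlift (mu1 ++ mu2) nu ->
  exists nu1 nu2, [/\ mlift mu1 nu1, mlift mu2 nu2 & nu = nu1 ++ nu2].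
Proof.
elim: mu1 nu => [|[p a] mu1 IH] nu /=.
  by exists [::], nu; split => //; exact: mlift_nil.
move=> /mlift_cons_inv[mua [nu' [ta /IH[nu1 [nu2 [l1 l2 ->]]] ->]]].
by exists (mscale p mua ++ nu1), nu2; rewrite catA; split => //; apply: mlift_cons.
Qed.

Lemma mscale_cat p mu nu : mscale p (mu ++ nu) = mscale p mu ++ mscale p nu.
Proof. exact: map_cat. Qed.

Lemma mscaleA p q mu : mscale p (mscale q mu) = mscale (p * q) mu.
Proof. by rewrite /mscale -map_comp; apply: eq_map => x /=; rewrite mulrA. Qed.

Lemma mscale1 mu : mscale 1 mu = mu.
Proof. by rewrite /mscale -[RHS]map_id; apply: eq_map => -[p a] /=; rewrite mul1r. Qed.

Lemma mlift_mscale q mu nu : mlift mu nu -> mlift (mscale q mu) (mscale q nu).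
Proof.
elim=> [|p a mua {}mu {}nu ta _ IH]; first exact: mlift_nil.
by rewrite mscale_cat mscaleA; apply: mlift_cons.
Qed.

Lemma mlift_perm mu nu mu' : mlift mu nu -> perm_eq mu mu' ->
  exists2 nu', perm_eq nu nu' & mlift mu' nu'.
Proof.
elim: mu' mu nu => [|[p a] mu' IH] mu nu l.
  by move=> /perm_nilP e; rewrite e in l; rewrite (mlift_nil_inv l); exists [::] => //; exact: mlift_nil.
move=> pe; have : (p, a) \in mu by rewrite (perm_mem pe) mem_head.
move=> /splitPr e; case: e l pe => mu1 mu2 l pe.
have [nu1 [nu2 [l1 /mlift_cons_inv[mua [nu3 [ta l3 ->]]] ->]]] := mlift_cat_inv l.
have [|nu' pnu' l'] := IH _ _ (mlift_cat l1 l3).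
  by rewrite -(perm_cons (p, a)) -(permPr pe) -cat1s perm_catCA.
exists (mscale p mua ++ nu'); last exact: mlift_cons.
by rewrite perm_catCA perm_cat2l.
Qed.

(** All reorderings can be postponed to the target, because by [mlift_perm] a permutation of the
    source only permutes the result. *)
Lemma lifting_mlift mu nu : lifting to mu nu ->
  exists2 nu', perm_eq nu nu' & mlift mu nu'.
Proof.
elim=> {mu nu} [a nfa|a mu ta|k p mu nu p0 p1 _ IH|mu mu' nu nu' pmu pnu _ [nu1 pnu1 l]].
- exists [:: (1, a)] => //.
  rewrite -[X in mlift _ X]mscale1 -[X in mlift _ X]cats0.
  by apply: mlift_cons mlift_nil; left.
- exists mu => //; rewrite -[X in mlift _ X]mscale1 -[X in mlift _ X]cats0.
  by apply: mlift_cons mlift_nil; right.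
- rewrite /munion; elim: (index_enum _) => [|j r [nu' pnu' l]].
    by rewrite !big_nil; exists [::] => //; exact: mlift_nil.
  rewrite !big_cons; have [nuj pj lj] := IH j.
  exists (mscale (p j) nuj ++ nu'); last by apply: mlift_cat l; apply: mlift_mscale.
  by apply: perm_cat => //; apply: perm_map.
- have [nu2 pnu2 l2] := mlift_perm l pmu; exists nu2 => //.
  by rewrite perm_sym in pnu; apply: perm_trans pnu (perm_trans pnu1 pnu2).
Qed.

Lemma mlift_zip mu nu : mlift mu nu -> exists zs : seq (R * A * multidist R A),
  [/\ forall z, z \in zs -> nf_step z.1.2 z.2,
      mu = [seq z.1 | z <- zs] &
      nu = \big[cat/[::]]_(z <- zs) mscale z.1.1 z.2].
Proof.
elim=> [|p a mua {}mu {}nu ta _ [zs [tzs -> ->]]].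
  by exists [::]; rewrite big_nil.
exists ((p, a, mua) :: zs); rewrite big_cons; split => // z.
by rewrite inE => /orP[/eqP -> //|]; apply: tzs.
Qed.

Lemma nf_step_lifting a mu : nf_step a mu -> lifting to [:: (1, a)] mu.
Proof. by case=> [[nfa ->]|ta]; [exact: lifting_nf|exact: lifting_step]. Qed.

Lemma munion_tnth (J : Type) (zs : seq J) (p : J -> R) (f : J -> multidist R A) :
  munion (fun j : 'I_(size zs) => p (tnth (in_tuple zs) j))
         (fun j => f (tnth (in_tuple zs) j)) =
  \big[cat/[::]]_(z <- zs) mscale (p z) (f z).
Proof. by rewrite /munion [RHS]big_tnth. Qed.

(** [mu] is the convex union of its items taken with probability 1, and each item makes a step or
    stays as a normal form; [FDist] supplies the conditions on the weights. *)
Lemma mlift_lifting D mu nu : FDist D mu -> mlift mu nu -> lifting to mu nu.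
Proof.
move=> [p01 p1 _] /mlift_zip[zs [tzs emu ->]].
rewrite -(munion_tnth zs (fun z => z.1.1) snd).
have -> : mu = munion (fun j : 'I_(size zs) => (tnth (in_tuple zs) j).1.1)
  (fun j => [:: (1, (tnth (in_tuple zs) j).1.2)]).
  rewrite (munion_tnth zs (fun z => z.1.1) (fun z => [:: (1, z.1.2)])) emu.
  elim: (zs) => [|[[p a] m] r IH]; first by rewrite big_nil.
  by rewrite big_cons /= mulr1 IH.
apply: lifting_union.
- move=> j; suff /p01/andP[] : (tnth (in_tuple zs) j).1 \in mu by [].
  by rewrite emu; apply: map_f; apply: mem_tnth.
- by rewrite -p1 emu big_map [RHS]big_tnth.
- by move=> j; apply/nf_step_lifting/tzs/mem_tnth.
Qed.

Lemma mem_mscale p mu x : x \in mscale p mu -> exists2 y, y \in mu & x = (p * y.1, y.2).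
Proof. by move=> /mapP. Qed.

Lemma mem_bigcat (J : eqType) (r : seq J) (f : J -> multidist R A) x :
  x \in \big[cat/[::]]_(y <- r) f y -> exists2 y, y \in r & x \in f y.
Proof.
elim: r => [|y r IH]; first by rewrite big_nil.
rewrite big_cons mem_cat => /orP[xy|/IH[z zr xz]]; first by exists y; rewrite ?mem_head.
by exists z => //; rewrite inE zr orbT.
Qed.

Lemma mlift_FDist D mu nu : step_closed D -> FDist D mu -> mlift mu nu -> FDist D nu.
Proof.
move=> cD [p01 p1 Dmu] l.
have [s pos] : \sum_(x <- nu) x.1 = \sum_(x <- mu) x.1 /\
   forall x, x \in nu -> 0 < x.1 <= 1 /\ D x.2; last first.
  by split; [move=> x /pos[]|rewrite s|move=> x /pos[]].
elim: l p01 Dmu {p1} => [|p a mua {}mu {}nu ta _ IH] p01 Dmu.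
  by split => // x; rewrite in_nil.
have [|x xmu|s pos] := IH.
- by move=> x xmu; apply: p01; rewrite inE xmu orbT.
- by apply: Dmu; rewrite inE xmu orbT.
have [q01 q1 _] := nf_step_FDist ta.
have /p01/= /andP[pp0 pp1] : (p, a) \in (p, a) :: mu by rewrite mem_head.
have Da : D a by apply: (Dmu (p, a)); rewrite mem_head.
split.
  by rewrite big_cons big_cat s /= big_map /= -mulr_sumr q1 mulr1.
move=> x; rewrite mem_cat => /orP[|/pos //].
move=> /mem_mscale[y ymua ->] /=; have /andP[y0 y1] := q01 _ ymua.
split; first by rewrite mulr_gt0 //= mulr_ile1 // ltW.
case: ta => [[_ e]|ta]; last exact: cD Da ta ymua.
by move: ymua; rewrite e inE => /eqP -> /=.
Qed.

(** * The mass outside normal forms and its evolution along liftings *)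

Definition alive mu : R := Ex mu (fun a => if `[< normal_form to a >] then 0 else 1).

Lemma nf_probE D mu : FDist D mu -> nf_prob to mu = 1 - alive mu.
Proof.
case=> _ p1 _; rewrite /nf_prob /alive /Ex -[X in _ = X - _]p1 big_mkcond -sumrB; apply: eq_bigr => x _.
by case: ifP => _; rewrite ?mulr0 ?mulr1 ?subr0 ?subrr.
Qed.

Lemma alive_ge0 mu : (forall x, x \in mu -> 0 <= x.1) -> 0 <= alive mu.
Proof. by move=> p0; apply: Ex_ge0 => // x _; case: ifP. Qed.

Lemma alive_le1 D mu : FDist D mu -> alive mu <= 1.
Proof.
move=> dmu; have dmu' : FDist setT mu by case: dmu.
rewrite /alive -[leRHS](Ex_cst _ dmu'); apply: ler_Ex => [|x _]; first exact: FDist_ge0 dmu.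
by case: ifP.
Qed.

Lemma Ex_perm mu nu w : perm_eq mu nu -> Ex mu w = Ex nu w.
Proof. by move=> p; apply: perm_big. Qed.

Lemma mlift_ge0 mu nu : mlift mu nu -> (forall x, x \in mu -> 0 <= x.1) ->
  forall x, x \in nu -> 0 <= x.1.
Proof.
elim=> [//|p a mua {}mu {}nu ta _ IH] p0 x; rewrite mem_cat => /orP[|].
  move=> /mem_mscale[y ymua ->] /=; rewrite mulr_ge0 //.
    by apply: (p0 (p, a)); rewrite mem_head.
  exact: FDist_ge0 (nf_step_FDist ta) _ ymua.
by apply: IH => y ymu; apply: p0; rewrite inE ymu orbT.
Qed.

Lemma ler_Ex_mlift mu nu (v w : A -> R) : mlift mu nu ->
  (forall x, x \in mu -> 0 <= x.1) ->
  (forall x mua, x \in mu -> nf_step x.2 mua -> Ex mua w <= v x.2) ->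
  Ex nu w <= Ex mu v.
Proof.
elim=> [|p a mua {}mu {}nu ta _ IH] p0 le; first by rewrite /Ex !big_nil.
rewrite Ex_cat Ex_mscale [leRHS]/Ex big_cons /=; apply: lerD.
  by rewrite ler_wpM2l ?(le (p, a)) ?(p0 (p, a)) ?mem_head.
by apply: IH => [x xmu|x mux xmu]; [apply: p0|apply: le]; rewrite inE xmu orbT.
Qed.

Lemma alive_mlift mu nu : mlift mu nu -> (forall x, x \in mu -> 0 <= x.1) ->
  alive nu <= alive mu.
Proof.
move=> l p0; apply: ler_Ex_mlift l p0 _ => x mua xmu tx.
have dmua := nf_step_FDist tx.
case: asboolP => nfx; last exact: alive_le1 dmua.
case: tx => [[_ ->]|tx]; last by case: nfx; exists mua.
by rewrite /Ex big_seq1 /= asboolT // mulr0.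
Qed.

(** * Runs of schedulers, and from [AST] to certificates *)

Lemma FDist1 D a : D a -> FDist D ([:: (1, a)] : multidist R A).
Proof.
move=> Da; split; rewrite ?big_seq1 // => x; rewrite inE => /eqP -> //=.
by rewrite ltr01 lexx.
Qed.

(** [f] is a scheduler whose choice depends on the time and on the current object. *)
Fixpoint run (f : nat -> A -> multidist R A) mu n : multidist R A :=
  if n is n'.+1 then \big[cat/[::]]_(x <- run f mu n') mscale x.1 (f n' x.2) else mu.

Lemma mlift_run f mu n : (forall k a, nf_step a (f k a)) ->
  mlift (run f mu n) (run f mu n.+1).
Proof.
move=> tf /=; elim: (run f mu n) => [|[p a] r IH]; first by rewrite big_nil; exact: mlift_nil.
by rewrite big_cons; apply: mlift_cons.
Qed.

Lemma run_lifting_seq D f mu : step_closed D -> (forall k a, nf_step a (f k a)) ->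
  FDist D mu -> lifting_seq D to (run f mu).
Proof.
move=> cD tf dmu.
have d n : FDist D (run f mu n).
  by elim: n => // n IH; apply: mlift_FDist cD IH (mlift_run _ _ tf).
by split=> // n; apply: mlift_lifting (d n) (mlift_run _ _ tf).
Qed.

Lemma nf_step_exists a : exists mu, nf_step a mu.
Proof.
have [[mu ta]|nfa] := pselect (exists mu, to a mu); first by exists mu; right.
by exists [:: (1, a)]; left.
Qed.

(** If [v a] were positive, always choosing nearly optimal steps for [v] would keep the expectation
    of [v] above [v a / 2]. As [v] is at most 1 and vanishes on normal forms, at least this mass
    would stay alive forever. *)
Lemma AST_ast_at D a : step_closed D -> AST D to -> D a -> ast_at to a.
Proof.
move=> cD ast Da v [v01 vp]; rewrite leNgt; apply/negP => va0.
(* The errors [v a / 2 ^+ n.+2] sum up to [v a / 2]. *)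
have /choice[f] : forall n : nat, exists fn : A -> multidist R A, forall x,
    nf_step x (fn x) /\ v x <= Ex (fn x) v + v a / 2 ^+ n.+2.
  move=> n; suff /choice[fn fnP] : forall x, exists mu,
    nf_step x mu /\ v x <= Ex mu v + v a / 2 ^+ n.+2 by exists fn.
  move=> x; have e0 : 0 < v a / 2 ^+ n.+2 by rewrite divr_gt0 // exprn_gt0.
  have [vx0|vx0] := ltP 0 (v x).
    by have [mu tx le] := vp _ vx0 _ e0; exists mu; split => //; right.
  have [mu tx] := nf_step_exists x; exists mu; split => //.
  apply: le_trans vx0 _; apply: addr_ge0 (ltW e0).
  apply: Ex_ge0 => [|y _]; last by case/andP: (v01 y.2).
  exact: FDist_ge0 (nf_step_FDist tx).
move=> fP; have tf k x : nf_step x (f k x) by have [] := fP k x.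
have [drun lrun] := run_lifting_seq cD tf (FDist1 Da).
have Erun n : v a / 2 + v a / 2 ^+ n.+1 <= Ex (run f [:: (1, a)] n) v.
  elim: n => [|n IH]; first by rewrite /= /Ex big_seq1 mul1r expr1; lra.
  have : Ex (run f [:: (1, a)] n) (fun x => v x - v a / 2 ^+ n.+2) <= Ex (run f [:: (1, a)] n.+1) v.
    rewrite /= {2}/Ex.
    elim: (run f [:: (1, a)] n) (FDist_ge0 (drun n)) => [_|[p x] r IHr p0].
      by rewrite /Ex !big_nil.
    rewrite big_cons big_cat /= /Ex big_cons /=; apply: lerD; last first.
      by apply: IHr => y yr; apply: p0; rewrite inE yr orbT.
    rewrite -[leRHS]/(Ex (mscale p (f n x)) v) Ex_mscale ler_wpM2l //.
      by apply: (p0 (p, x)); rewrite mem_head.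
    by have [_] := fP n x; lra.
  rewrite Ex_addr Ex_cst; last by case: (drun n).
  have E2 : v a / 2 ^+ n.+1 = v a / 2 ^+ n.+2 + v a / 2 ^+ n.+2 :> R.
    by rewrite [2 ^+ n.+2]exprS invfM mulrCA; lra.
  by move: IH; rewrite E2; lra.
have := ast _ (conj drun lrun).
have le n : nf_prob to (run f [:: (1, a)] n) <= 1 - v a / 2.
  rewrite (nf_probE (drun n)) lerD2l lerN2.
  have : Ex (run f [:: (1, a)] n) v <= alive (run f [:: (1, a)] n).
    apply: ler_Ex => [|x _]; first exact: FDist_ge0 (drun n).
    case: asboolP => [nfx|_]; last by case/andP: (v01 x.2).
    exact: ast_at_nf nfx _ (conj v01 vp).
  have : 0 < v a / 2 ^+ n.+1 by rewrite divr_gt0 // exprn_gt0.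
  by have := Erun n; lra.
move=> cv; have : (1 : R) <= 1 - v a / 2.
  by apply: cvgr_to_le cv _; apply: nearW => n; apply: le.
by lra.
Qed.

(** * Survival probabilities, and from certificates to [AST] *)

Definition mlift_seq (mu : nat -> multidist R A) : Prop :=
  forall n, mlift (mu n) (mu n.+1).

(* [survival a] is the supremal probability of an infinite run from [a]; the free
   weight [p] avoids renormalizing the components of a sequence. *)
Definition survivals a : set R := [set c | c = 0 \/
  exists (p : R) (mu : nat -> multidist R A), [/\ 0 < p, mlift_seq mu, mu 0%N = [:: (p, a)] &
    forall n, p * c <= alive (mu n)]].

Definition survival a : R := sup (survivals a).

Lemma survival_ub a : ubound (survivals a) 1.
Proof.
move=> c [->//|[p [mu [p0 _ mu0 /(_ 0%N)]]]].
rewrite mu0 /alive /Ex big_seq1 /= => h.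
have : p * c <= p * 1 by apply: le_trans h _; rewrite ler_pM2l //; case: ifP.
by rewrite ler_pM2l.
Qed.

Lemma survival_ge0 a : 0 <= survival a.
Proof. by apply: ub_le_sup; [exists 1; exact: survival_ub|left]. Qed.

Lemma mlift_seq_ge0 (mu : nat -> multidist R A) : mlift_seq mu -> (forall x, x \in mu 0%N -> 0 <= x.1) ->
  forall n x, x \in mu n -> 0 <= x.1.
Proof. by move=> l p0; elim=> // n IH; apply: mlift_ge0 (l n) IH. Qed.

Lemma mlift_seq_alive (mu : nat -> multidist R A) : mlift_seq mu -> (forall x, x \in mu 0%N -> 0 <= x.1) ->
  forall n k, (n <= k)%N -> alive (mu k) <= alive (mu n).
Proof.
move=> l p0 n k /subnK <-; elim: (k - n)%N => // i IH.
by apply: le_trans IH; rewrite addSn; apply: alive_mlift (l _) _; apply: mlift_seq_ge0.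
Qed.

Lemma mlift_seq_cat (mu : nat -> multidist R A) mu1 mu2 : mlift_seq mu -> mu 0%N = mu1 ++ mu2 ->
  exists nu1 nu2 : nat -> multidist R A, [/\ mlift_seq nu1, mlift_seq nu2, nu1 0%N = mu1, nu2 0%N = mu2 &
    forall n, mu n = nu1 n ++ nu2 n].
Proof.
move=> l mu0.
(* A splitting at one time determines no particular splitting at the next. The states carry the time
   with a splitting, so that successors can be chosen and iterated. *)
pose X := {p : nat * multidist R A * multidist R A | mu p.1.1 = p.1.2 ++ p.2}.
have ex (x : X) : exists y : X, [/\ (sval y).1.1 = (sval x).1.1.+1,
    mlift (sval x).1.2 (sval y).1.2 & mlift (sval x).2 (sval y).2].
  case: x => [[[n m1] m2] /= e].
  have := l n; rewrite e => /mlift_cat_inv[n1 [n2 [l1 l2 e']]].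
  by exists (exist _ (n.+1, n1, n2) e').
have [f fP] := choice ex.
pose x0 : X := exist _ (0%N, mu1, mu2) mu0.
pose F n := sval (iter n f x0).
have F1 n : (F n).1.1 = n.
  by elim: n => // n IH; rewrite /F iterS; have [-> _ _] := fP (iter n f x0); rewrite -/(F n) IH.
exists (fun n => (F n).1.2), (fun n => (F n).2); split => //.
- by move=> n; rewrite /F iterS; have [] := fP (iter n f x0).
- by move=> n; rewrite /F iterS; have [] := fP (iter n f x0).
- by move=> n; have := svalP (iter n f x0); rewrite -/(F n) F1.
Qed.

Lemma alive_cat mu nu : alive (mu ++ nu) = alive mu + alive nu.
Proof. exact: Ex_cat. Qed.

(** The sequence splits into one sequence per initial item, each of which eventually falls to its
    survival mass up to an error. There are finitely many items and [alive] never increases, so the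
    latest of these times serves for all. *)
Lemma mlift_seq_survival (mu : nat -> multidist R A) : mlift_seq mu -> (forall x, x \in mu 0%N -> 0 < x.1) ->
  forall e, 0 < e -> exists n, alive (mu n) <= Ex (mu 0%N) survival + e.
Proof.
move: {2}(mu 0%N) (erefl (mu 0%N)) => m; elim: m mu => [|[p a] m IH] mu mu0 l p0 e e0.
  by exists 0%N; rewrite mu0 /alive /Ex !big_nil add0r ltW.
have [nu1 [nu2 [l1 l2 nu10 nu20 E]]] := mlift_seq_cat l (mu0 : _ = [:: (p, a)] ++ m).
have pp : 0 < p by apply: (p0 (p, a)); rewrite mu0 mem_head.
have pm x : x \in m -> 0 < x.1 by move=> xm; apply: p0; rewrite mu0 inE xm orbT.
have e20 : 0 < e / 2 by rewrite divr_gt0.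
have [|n2 le2] := IH nu2 nu20 l2 _ _ e20; first by move=> x; rewrite nu20; apply: pm.
have [n1 le1] : exists n, alive (nu1 n) <= p * survival a + e / 2.
  apply: contrapT => /forallNP H.
  (* Otherwise [nu1] would witness a survival probability beyond the supremum. *)
  have : survival a + e / 2 / p <= survival a.
    apply: ub_le_sup; first by exists 1; exact: survival_ub.
    right; exists p, nu1; split => // n; apply: ltW.
    by rewrite mulrDr mulrCA divff ?gt_eqF // mulr1 ltNge; apply/negP/H.
  have : 0 < e / 2 / p by rewrite divr_gt0.
  by lra.
exists (maxn n1 n2); rewrite E alive_cat mu0 /Ex big_cons /= -nu20.
have : alive (nu1 (maxn n1 n2)) <= alive (nu1 n1).
  apply: mlift_seq_alive (leq_maxl _ _) => // x.
  by rewrite nu10 inE => /eqP ->; apply: ltW.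
have : alive (nu2 (maxn n1 n2)) <= alive (nu2 n2).
  by apply: mlift_seq_alive (leq_maxr _ _) => // x; rewrite nu20 => /pm/ltW.
by move: le2; rewrite nu20 /Ex; lra.
Qed.

(** A sequence with nearly maximal survival must begin with a proper step [mua], and its tail
    survives with at most the expected survival under [mua]. *)
Lemma postfixpoint_survival : postfixpoint to survival.
Proof.
split=> [a|a sa0 e e0].
  rewrite survival_ge0 /=; apply: ge_sup; [by exists 0; left|exact: survival_ub].
have hs : has_sup (survivals a) by split; [exists 0; left|exists 1; exact: survival_ub].
have [|c cS lt] := @sup_adherent _ _ (Num.min (e / 2) (survival a)) _ hs.
  by rewrite lt_min sa0 divr_gt0.
rewrite -/(survival a) in lt.
have ce : survival a < c + e / 2.
  by rewrite -ltrBlDr; apply: le_lt_trans lt; rewrite lerD2l lerN2 ge_min lexx.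
have c0 : 0 < c.
  by apply: le_lt_trans lt; rewrite subr_ge0 ge_min lexx orbT.
case: cS => [c00|[p [mu [p0 l mu0 ac]]]]; first by rewrite c00 ltxx in c0.
have := l 0%N; rewrite mu0 => /mlift_cons_inv[mua [nu [ta /mlift_nil_inv -> e1]]].
rewrite cats0 in e1.
case: ta => [[nfa _]|ta].
  have := ac 0%N; rewrite mu0 /alive /Ex big_seq1 /= asboolT // mulr0 leNgt.
  by rewrite mulr_gt0.
exists mua => //.
have l' : mlift_seq (fun n => mu n.+1) by move=> n; apply: l.
(* The sequence has total mass [p], hence the scaled error; the factor [p] cancels at the end. *)
have [|n] := @mlift_seq_survival _ l' _ (p * (e / 2)) (mulr_gt0 p0 (divr_gt0 e0 (ltr0n _ 2))).
  move=> x; rewrite e1 => /mem_mscale[y ymua ->]; rewrite mulr_gt0 //.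
  by have [h _ _] := to_FDist ta; case/andP: (h _ ymua).
rewrite e1 Ex_mscale -mulrDr => le.
have : p * c <= p * (Ex mua survival + e / 2) by apply: le_trans (ac n.+1) le.
by rewrite ler_pM2l //; lra.
Qed.

Lemma lifting_seq_mlift_seq D (mu : nat -> multidist R A) : lifting_seq D to mu ->
  exists2 nu : nat -> multidist R A, mlift_seq nu & forall n, perm_eq (mu n) (nu n).
Proof.
move=> [dmu l].
pose X := {p : nat * multidist R A | perm_eq (mu p.1) p.2}.
have ex (x : X) : exists y : X, (sval y).1 = (sval x).1.+1 /\ mlift (sval x).2 (sval y).2.
  case: x => [[n m] /= pm].
  have [nu pnu lnu] := lifting_mlift (l n).
  have [nu' pnu' lnu'] := mlift_perm lnu pm.
  by exists (exist _ (n.+1, nu') (perm_trans pnu pnu')).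
have [f fP] := choice ex.
pose x0 : X := exist _ (0%N, mu 0%N) (perm_refl _).
pose F n := sval (iter n f x0).
have F1 n : (F n).1 = n.
  by elim: n => // n IH; rewrite /F iterS; have [-> _] := fP (iter n f x0); rewrite -/(F n) IH.
exists (fun n => (F n).2).
- by move=> n; rewrite /F iterS; have [] := fP (iter n f x0).
- by move=> n; have := svalP (iter n f x0); rewrite -/(F n) F1.
Qed.

(** The survival probability is a postfixpoint and therefore vanishes on [D]; so the decreasing mass
    outside normal forms gets below every [e]. *)
Lemma ast_at_AST D : (forall a, D a -> ast_at to a) -> AST D to.
Proof.
move=> N mu lmu; have [dmu _] := lmu.
have [nu lnu pnu] := lifting_seq_mlift_seq lmu.
have p0 x : x \in nu 0%N -> 0 < x.1.
  by rewrite -(perm_mem (pnu 0%N)); have [h _ _] := dmu 0%N => /h /andP[].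
have E0 : Ex (nu 0%N) survival <= 0.
  rewrite -(Ex_perm _ (pnu 0%N)) /Ex big_seq.
  apply: sumr_le0 => x xmu; rewrite mulr_ge0_le0 //.
    exact: FDist_ge0 (dmu 0%N) _ xmu.
  by apply: N postfixpoint_survival; have [_ _ h] := dmu 0%N; apply: h.
apply/cvgrPdist_le => e e0.
have [n le] := mlift_seq_survival lnu p0 e0.
exists n => // k /= nk; rewrite (nf_probE (dmu k)) opprB addrCA subrr addr0.
have -> : alive (mu k) = alive (nu k) by apply: Ex_perm.
have p0' x : x \in nu 0%N -> 0 <= x.1 by move=> /p0/ltW.
rewrite ger0_norm; last by apply: alive_ge0; apply: mlift_seq_ge0.
by have := mlift_seq_alive lnu p0' nk; lra.
Qed.

(** * Expected derivation lengths, and [SAST] against certificates *)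

Lemma edl_le D (mu : nat -> multidist R A) (K : R) : lifting_seq D to mu ->
  (forall N, \sum_(0 <= n < N) alive (mu n) <= K) <-> (edl to mu <= K%:E)%E.
Proof.
move=> [dmu _].
have E N : (\sum_(0 <= n < N) (1 - nf_prob to (mu n))%:E = (\sum_(0 <= n < N) alive (mu n))%:E)%E.
  by rewrite sumEFin; congr (_%:E); apply: eq_bigr => n _; rewrite (nf_probE (dmu n)) opprB addrCA subrr addr0.
have ge0 n : xpredT n -> (0 <= (1 - nf_prob to (mu n))%:E)%E.
  by rewrite lee_fin (nf_probE (dmu n)) opprB addrCA subrr addr0 => _; apply: alive_ge0; apply: FDist_ge0 (dmu n).
split=> [h|h N].
  rewrite /edl; apply: lime_le; first by apply: is_cvg_nneseries => n _ _; apply: ge0.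
  by apply: nearW => N; rewrite E lee_fin.
rewrite -lee_fin -E; apply: le_trans h; apply: nneseries_lim_ge => n _; exact: ge0.
Qed.

(** By induction on [N], the mass alive before time [N], summed over time, plus the expectation of
    [W] at time [N] never exceeds [W a]. *)
Lemma sast_at_SAST D : (forall a, D a -> sast_at to a) -> SAST D to.
Proof.
move=> H a /H [E [W [pW Ea]]].
apply: (@le_lt_trans _ _ (W a)%:E); last exact: ltry.
apply: ge_ereal_sup => _ [mu [lmu mu0] <-].
apply/(edl_le _ lmu) => N.
have [dmu l] := lmu.
have [nu lnu pnu] := lifting_seq_mlift_seq lmu.
suff : (forall x, x \in nu N -> E x.2) /\
       \sum_(0 <= n < N) alive (mu n) + Ex (nu N) W <= W a.
  move=> [EN]; apply: le_trans; rewrite lerDl; apply: Ex_ge0 => x xN.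
    by move: xN; rewrite -(perm_mem (pnu N)); apply: FDist_ge0 (dmu N) _.
  by have [] := pW _ (EN _ xN).
elim: N => [|N [EN IH]].
  rewrite big_nil add0r -(Ex_perm _ (pnu 0%N)) mu0 /Ex big_seq1 mul1r; split => // x.
  by rewrite -(perm_mem (pnu 0%N)) mu0 inE => /eqP ->.
have pN x : x \in nu N -> 0 <= x.1 by rewrite -(perm_mem (pnu N)); apply: FDist_ge0 (dmu N) _.
split.
  have := lnu N; move: (nu N.+1); elim: (nu N) EN => [|[p b] m IHm] EN nn.
    by move=> /mlift_nil_inv ->.
  move=> /mlift_cons_inv[mub [nu' [tb l' ->]]] x; rewrite mem_cat => /orP[|].
    move=> /mem_mscale[y ymub ->] /=.
    have Eb : E b by apply: (EN (p, b)); rewrite mem_head.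
    case: tb => [[_ e]|tb]; first by move: ymub; rewrite e inE => /eqP ->.
    by have [_ /(_ _ tb)[h _]] := pW _ Eb; apply: h.
  by apply: IHm l' x => y ym; apply: EN; rewrite inE ym orbT.
rewrite big_nat_recr //=.
suff : alive (mu N) + Ex (nu N.+1) W <= Ex (nu N) W by lra.
have -> : alive (mu N) = alive (nu N) by apply: Ex_perm.
rewrite -lerBrDl /alive.
have -> : Ex (nu N) W - Ex (nu N) (fun a => if `[< normal_form to a >] then 0 else 1) =
  Ex (nu N) (fun a => W a - if `[< normal_form to a >] then 0 else 1).
  by rewrite Ex_addr; congr (_ + _); rewrite /Ex -sumrN; apply: eq_bigr => x _; rewrite mulrN.
apply: ler_Ex_mlift (lnu N) pN _ => x mux /EN Ex2 tx.
case: asboolP => nfx.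
  case: tx => [[_ ->]|tx]; last by case: nfx; exists mux.
  by rewrite /Ex big_seq1 mul1r subr0.
case: tx => [[]//|tx].
by have [_ /(_ _ tx)[_]] := pW _ Ex2; lra.
Qed.

Lemma SAST_bounded D a : SAST D to -> D a -> exists K : R, forall (mu : nat -> multidist R A) N,
  lifting_seq D to mu -> mu 0%N = [:: (1, a)] -> \sum_(0 <= n < N) alive (mu n) <= K.
Proof.
move=> H /H; set s := ereal_sup _ => slt.
have le (mu : nat -> multidist R A) : lifting_seq D to mu -> mu 0%N = [:: (1, a)] -> (edl to mu <= s)%E.
  by move=> l mu0; apply: ereal_sup_ubound; exists mu.
case: s slt le => [r _ le|//|_ le].
  by exists r => mu N l mu0; apply: (edl_le r l).2 (le _ l mu0) _.
(* What remains is the supremum of value minus infinity, where 0 is a bound as well. *)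
exists 0 => mu N l mu0; apply: (edl_le 0 l).2 _ _.
by apply: le_trans (le _ l mu0) _; rewrite leNye.
Qed.

(** The potential of [b] is the supremum of the partial sums of alive mass over sequences from [b].
    A step followed by nearly optimal sequences from its results is again a sequence, one time unit
    longer. *)
Lemma SAST_sast_at D a : step_closed D -> SAST D to -> D a -> sast_at to a.
Proof.
move=> cD sast Da.
pose S a := [set c | exists (mu : nat -> multidist R A) N, [/\ lifting_seq D to mu, mu 0%N = [:: (1, a)] &
   c = \sum_(0 <= n < N) alive (mu n)]].
have Sub b : D b -> has_ubound (S b).
  by move=> /(SAST_bounded sast)[K HK]; exists K => _ [mu [N [l mu0 ->]]]; apply: HK.
have Sne b : D b -> S b !=set0.
  move=> Db; have [f fP] := choice nf_step_exists.
  by eexists; exists (run (fun=> f) [:: (1, b)]), 0%N; split => //; apply: run_lifting_seq => //; apply: FDist1.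
have ge0 b c : D b -> S b c -> 0 <= c.
  move=> _ [mu [N [[dmu _] _ ->]]]; apply: sumr_ge0 => n _; apply: alive_ge0.
  exact: FDist_ge0 (dmu n).
exists D, (fun b => sup (S b)); split => // {Da} {}a Da; split.
  have [c Sc] := Sne _ Da; apply: le_trans (ge0 _ _ Da Sc) _; apply: ub_le_sup => //; exact: Sub.
move=> mu ta; split; first by move=> x; apply: cD Da ta.
apply/ler_addgt0Pr => e e0.
have dmu : FDist setT mu := to_FDist ta.
have Dmu x : x \in mu -> D x.2 by apply: cD Da ta.
have [p01 p1 _] := dmu.
(* [g b] is a sequence from [b] with a horizon at which the supremum is attained up to [e]; outside
   [D] it is a dummy. *)
have /choice[g gP] : forall b : A, exists s : (nat -> multidist R A) * nat, D b ->
    [/\ lifting_seq D to s.1, s.1 0%N = [:: (1, b)] &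
      sup (S b) <= \sum_(0 <= n < s.2) alive (s.1 n) + e].
  move=> b; have [Db|nDb] := pselect (D b); last by exists (fun=> [::], 0%N).
  have [_ [nu [N [l nu0 ->]]] lt] := sup_adherent e0 (conj (Sne _ Db) (Sub _ Db)).
  by exists (nu, N) => _; split => //=; lra.
(* First the step to [mu], then the chosen sequences side by side, delayed by one and weighted by
   [mu]. *)
pose nu n := if n is n'.+1 then \big[cat/[::]]_(x <- mu) mscale x.1 ((g x.2).1 n') else [:: (1, a)].
(* A common horizon; prolonging a sum adds only nonnegative terms. *)
pose N := \max_(x <- mu) (g x.2).2.
have Exnu n w : Ex (nu n.+1) w = \sum_(x <- mu) x.1 * Ex ((g x.2).1 n) w.
  rewrite /nu; elim: (mu) => [|x m IH]; first by rewrite !big_nil /Ex big_nil.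
  by rewrite !big_cons Ex_cat IH Ex_mscale.
have nu1 : nu 1%N = mu.
  rewrite /nu; elim: (mu) Dmu => [|[p b] m IH] Dm; first by rewrite big_nil.
  rewrite big_cons IH; last by move=> x xm; apply: Dm; rewrite inE xm orbT.
  by have [_ -> _] := gP b (Dm (p, b) (mem_head _ _)); rewrite /= mulr1.
have lnu : lifting_seq D to nu.
  split=> [[|n]|[|n]].
  - exact: FDist1.
  - split.
    + move=> x /mem_bigcat[y ymu /mem_mscale[z zg ->]] /=.
      have [[dg _] _ _] := gP _ (Dmu _ ymu); have [q01 _ _] := dg n.
      have /andP[z0 z1] := q01 _ zg; have /andP[y0 y1] := p01 _ ymu.
      by rewrite mulr_gt0 //= mulr_ile1 // ltW.
    + have := Exnu n (fun=> 1); rewrite {1}/Ex => h.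
      transitivity (\sum_(x <- nu n.+1) x.1 * 1); first by apply: eq_bigr => x _; rewrite mulr1.
      rewrite h -[RHS]p1 !big_seq; apply: eq_bigr => x xmu.
      have [[dg _] _ _] := gP _ (Dmu _ xmu); rewrite Ex_cst ?mulr1 //.
      by have [? ? _] := dg n.
    + move=> x /mem_bigcat[y ymu /mem_mscale[z zg ->]] /=.
      have [[dg _] _ _] := gP _ (Dmu _ ymu); have [_ _ q] := dg n.
      exact: q.
  - by rewrite nu1; apply: lifting_step.
  - rewrite /nu -!(munion_tnth mu fst (fun x => (g x.2).1 _)).
    apply: lifting_union.
    + by move=> j; case/andP: (p01 _ (mem_tnth j (in_tuple mu))).
    + by rewrite -p1 [RHS]big_tnth.
    + by move=> j; have [[_ lg] _ _] := gP _ (Dmu _ (mem_tnth j (in_tuple mu))); apply: lg.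
have : \sum_(0 <= n < N.+1) alive (nu n) <= sup (S a).
  by apply: ub_le_sup; [exact: Sub|exists nu, N.+1].
rewrite big_nat_recl //.
have -> : alive (nu 0%N) = 1.
  by rewrite /alive /Ex big_seq1 mul1r asboolF // => nfa; apply: nfa; exists mu.
have -> : \sum_(0 <= n < N) alive (nu n.+1) =
    Ex mu (fun b => \sum_(0 <= n < N) alive ((g b).1 n)).
  rewrite /Ex; under eq_bigr do rewrite /alive Exnu.
  by rewrite exchange_big; apply: eq_bigr => x _; rewrite mulr_sumr.
suff : Ex mu (fun b => sup (S b)) <= Ex mu (fun b => \sum_(0 <= n < N) alive ((g b).1 n)) + e by lra.
rewrite -[X in _ <= _ + X](Ex_cst _ dmu) -Ex_addr; apply: ler_Ex; first exact: FDist_ge0 dmu.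
move=> x xmu; have [[dg _] _ le] := gP _ (Dmu _ xmu).
apply: le_trans le _; rewrite lerD2r.
have le2 : ((g x.2).2 <= N)%N by rewrite /N (big_rem x xmu) /= leq_maxl.
rewrite [leRHS](big_cat_nat (n := (g x.2).2)) //= lerDl; apply: sumr_ge0 => n _.
by apply: alive_ge0; apply: FDist_ge0 (dg n).
Qed.

End Sequences.

(** * Terms, rewriting and skeletons *)

Section Terms.
Context {F : Type} {ar : F -> nat}.
Local Notation T := (term ar).

(** The type of the arguments depends on [f], so [injection] only gives an equality of dependent
    pairs; classical decidability of equality on [F] resolves it. *)
Lemma App_inj f (ts us : 'I_(ar f) -> T) : App f ts = App f us -> ts = us.
Proof.
move=> e; injection e => h.
exact: (Eqdep_dec.inj_pair2_eq_dec _ (fun x y => pselect (x = y)) _ _ _ _ h).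
Qed.

Lemma subst_comp sigma tau (t : T) :
  subst sigma (subst tau t) = subst (fun x => subst sigma (tau x)) t.
Proof. by elim: t => //= f ts IH; congr App; apply/funext => i; apply: IH. Qed.

Lemma eq_in_subst sigma tau (t : T) :
  (forall x, vars t x -> sigma x = tau x) -> subst sigma t = subst tau t.
Proof.
elim: t => /= [x|f ts IH] e; first exact: e.
by congr App; apply/funext => i; apply: IH => x xi; apply: e; exists i.
Qed.

Lemma vars_subst sigma (t : T) y :
  vars (subst sigma t) y -> exists2 x, vars t x & vars (sigma x) y.
Proof.
elim: t => /= [x|f ts IH]; first by exists x.
by move=> [i /IH[x xi yx]]; exists x => //; exists i.
Qed.

Lemma terms_over_Var S x : terms_over S (Var x : T).
Proof. by move=> f []. Qed.

Lemma terms_over_subst S sigma (t : T) : terms_over S t ->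
  (forall x, vars t x -> terms_over S (sigma x)) -> terms_over S (subst sigma t).
Proof.
elim: t => /= [x _|f ts IH St Ss]; first exact.
move=> g /= [->|[i gi]]; first by apply: St; left.
apply: (IH i) gi => [h hi|x xi]; first by apply: St; right; exists i.
by apply: Ss; exists i.
Qed.

Lemma terms_over_subst_inv S sigma (t : T) x :
  terms_over S (subst sigma t) -> vars t x -> terms_over S (sigma x).
Proof.
elim: t => /= [y St ->//|f ts IH St [i xi]].
by apply: IH xi => g gi; apply: St; right; exists i.
Qed.

Lemma terms_over_App S f (ts : 'I_(ar f) -> T) :
  terms_over S (App f ts) <-> S f /\ forall i, terms_over S (ts i).
Proof.
split=> [St|[Sf Ss] g /= [->//|[i /Ss //]]].
by split=> [|i g gi]; apply: St; [left|right; exists i].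
Qed.

Lemma vars_bound (t : T) : exists m, forall x, vars t x -> (x < m)%N.
Proof.
elim: t => [y|f ts /choice[m mP]]; first by exists y.+1 => x ->.
exists (\max_i m i) => x [i /mP]; move/leq_trans; apply; exact: leq_bigmax.
Qed.

Definition setarg f (ts : 'I_(ar f) -> T) i a j := if j == i then a else ts j.

(* [sep Q t]: a variable occurring in two different arguments of a symbol of
   [t] satisfies [Q]; thus the variables violating [Q] occur at most once. *)
Fixpoint sep (Q : nat -> Prop) (t : T) : Prop :=
  match t with
  | Var _ => True
  | App f ts => (forall i, sep Q (ts i)) /\
      forall i j z, vars (ts i) z -> vars (ts j) z -> i <> j -> Q z
  end.

Lemma sep_sub (Q Q' : nat -> Prop) (t : T) :
  (forall z, Q z -> Q' z) -> sep Q t -> sep Q' t.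
Proof.
move=> QQ'; elim: t => //= f ts IH [s1 s2]; split=> [i|i j z zi zj ij].
  exact: IH.
exact/QQ'/(s2 i j).
Qed.

Lemma sep_vars (Q : nat -> Prop) (t : T) : (forall z, vars t z -> Q z) -> sep Q t.
Proof.
elim: t => //= f ts IH Qv; split=> [i|i j z zi _ _]; last by apply: Qv; exists i.
by apply: IH => z zi; apply: Qv; exists i.
Qed.

Lemma ord_le1 n (i j : 'I_n) : (n <= 1)%N -> i = j.
Proof.
by case: n i j => [|[|n]] // i j _; [case: i|rewrite (ord1 i) (ord1 j)].
Qed.

Lemma sep_unary S Q (t : T) : (forall f, S f -> (ar f <= 1)%N) -> terms_over S t -> sep Q t.
Proof.
move=> S1; elim: t => //= f ts IH /terms_over_App[Sf Ss]; split=> [i|i j z _ _ ij].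
  exact: IH.
by case: ij; apply: ord_le1; apply: S1.
Qed.

Lemma sep_rename (g : nat -> nat) (t : T) : injective g ->
  sep (fun=> False) t -> sep (fun=> False) (subst (fun x => Var (g x)) t).
Proof.
move=> ginj; elim: t => //= f ts IH [s1 s2]; split=> [i|i j z]; first exact: IH.
move=> /vars_subst[x xi ->] /vars_subst[y yj] /= /ginj xy ij.
by rewrite xy in xi; apply: s2 xi yj ij.
Qed.

End Terms.

(** * Rewrite steps and normal forms under contexts and substitutions *)

Section Rewriting.
Context {R : realType} {F : Type} {ar : F -> nat}.
Variable P : set (rule R ar).
Hypothesis hP : is_PTRS P.
Local Notation T := (term ar).
Local Notation Sigma := (sig_of P).
Local Notation nf := (normal_form (full_step P)).

Lemma rewrite_root ok l mu sigma : P (l, mu) -> ok (subst sigma l) ->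
  rewrite_with ok P (subst sigma l) (mmap (subst sigma) mu).
Proof.
move=> Pl okl; exists [::], l, mu, sigma; split => //; first by case: (subst sigma l).
by apply: eq_map => x; case: (subst sigma l).
Qed.

Lemma rewrite_arg ok f (ts : 'I_(ar f) -> T) i nu : rewrite_with ok P (ts i) nu ->
  rewrite_with ok P (App f ts) (mmap (fun a => App f (setarg ts i a)) nu).
Proof.
move=> [pi [l [mu [sigma [Pl e okl ->]]]]].
exists (val i :: pi), l, mu, sigma; split => //=.
  by rewrite valK.
rewrite /mmap -map_comp; apply: eq_map => x /=; congr (_, App f _).
by apply/funext => j; rewrite /setarg val_eqE; case: eqP => // ->.
Qed.

Lemma rewrite_Var ok x nu : ~ rewrite_with ok P (Var x) nu.
Proof.
move=> [[|i pi] [l [mu [sigma [Pl //= [e] _ _]]]]].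
by have [+ _ _] := hP.2 _ _ Pl; case: l e {Pl}.
Qed.

Lemma rewrite_App ok f (ts : 'I_(ar f) -> T) nu : rewrite_with ok P (App f ts) nu ->
  (exists l mu sigma, [/\ P (l, mu), App f ts = subst sigma l, ok (App f ts) &
     nu = mmap (subst sigma) mu]) \/
  (exists i nu', rewrite_with ok P (ts i) nu' /\
     nu = mmap (fun a => App f (setarg ts i a)) nu').
Proof.
move=> [[|i pi] [l [mu [sigma [Pl /= e okl ->]]]]].
  by case: e => e; left; exists l, mu, sigma; rewrite e; split.
right; move: e; case: insubP => // j _ ji e.
exists j, (mmap (fun r => replace_at (ts j) pi (subst sigma r)) mu); split.
  by exists pi, l, mu, sigma.
rewrite mmap_comp; apply: eq_map => x /=; congr (_, App f _).
by apply/funext => k; rewrite /setarg -ji val_eqE; case: eqP => // ->.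
Qed.

Lemma rewrite_full ok t nu : rewrite_with ok P t nu -> full_step P t nu.
Proof. by move=> [pi [l [mu [sigma [Pl e _ ->]]]]]; exists pi, l, mu, sigma. Qed.

Lemma full_step_subst kappa t nu : full_step P t nu ->
  full_step P (subst kappa t) (mmap (subst kappa) nu).
Proof.
elim: t nu => [x|f ts IH] nu; first by move=> /rewrite_Var.
case/rewrite_App => [[l [mu [sigma [Pl e _ ->]]]]|[i [nu' [/IH s ->]]]].
  rewrite e subst_comp mmap_comp.
  have -> : subst kappa \o subst sigma = subst (fun x => subst kappa (sigma x)) :> (T -> T).
    by apply/funext => t; apply: subst_comp.
  exact: rewrite_root.
have := @rewrite_arg _ f (fun i => subst kappa (ts i)) i _ s; rewrite !mmap_comp /=.
congr (full_step P _ (mmap _ _)); apply/funext => a /=; congr App; apply/funext => j.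
by rewrite /setarg; case: eqP.
Qed.

Lemma nf_subst kappa t : nf (subst kappa t) -> nf t.
Proof.
by move=> n [nu s]; apply: n; exists (mmap (subst kappa) nu); apply: full_step_subst.
Qed.

Lemma nf_arg f (ts : 'I_(ar f) -> T) i : nf (App f ts) -> nf (ts i).
Proof. by move=> n [nu s]; apply: n; eexists; apply: rewrite_arg s. Qed.

Lemma nf_subterm t pi u : nf t -> subterm_at t pi = Some u -> nf u.
Proof.
elim: t pi => [x|f ts IH] [|i pi] //= n; [by case=> <-|by case=> <-|].
by case: insubP => // j _ _; apply: IH; apply: nf_arg n.
Qed.

Lemma nf_subst_var b t z : nf (subst b t) -> vars t z -> nf (b z).
Proof.
elim: t => /= [x n ->//|f ts IH n [i zi]].
by apply: IH zi; apply: nf_arg n.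
Qed.

Definition ok_redex (s : strategy) : set T :=
  match s with
  | full => setT
  | innermost => [set r | forall u, proper_subterm u r -> nf u]
  end.

Lemma stepE s : step s P = rewrite_with (ok_redex s) P.
Proof. by case: s. Qed.

Lemma ok_innermost f (ts : 'I_(ar f) -> T) :
  ok_redex innermost (App f ts) <-> forall i, nf (ts i).
Proof.
split=> [ok i|n u [[//|i pi] _ /=]].
  by apply: ok; exists [:: val i] => //=; rewrite valK; case: (ts i).
by case: insubP => // j _ _; apply: nf_subterm.
Qed.

Lemma step_FDist s t nu : step s P t nu -> FDist setT nu.
Proof.
rewrite stepE => -[pi [l [mu [sigma [Pl _ _ ->]]]]].
have [_ d _] := hP.2 _ _ Pl; exact: (mmap_FDist (fun r => replace_at t pi (subst sigma r)) d).
Qed.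

Lemma rule_lhs_over l mu : P (l, mu) -> terms_over Sigma l.
Proof. by move=> Pl g gl; exists l, mu; split => //; left. Qed.

Lemma rule_rhs_over l mu x : P (l, mu) -> x \in mu -> terms_over Sigma x.2.
Proof. by move=> Pl xmu g gl; exists l, mu; split => //; right; exists x. Qed.

Lemma rule_vars l mu x : P (l, mu) -> x \in mu -> vars x.2 `<=` vars l.
Proof. by move=> Pl xmu; have [_ _] := hP.2 _ _ Pl; apply. Qed.

Lemma step_closed_over s : step_closed (step s P) (terms_over Sigma).
Proof.
move=> t nu x; rewrite stepE; elim: t nu x => [y|f ts IH] nu x St; first by move=> /rewrite_Var.
case/rewrite_App => [[l [mu [sigma [Pl e _ ->]]]]|[i [nu' [s' ->]]]] /mem_mmap[y ymu ->] /=.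
  apply: terms_over_subst; first exact: rule_rhs_over Pl ymu.
  move=> z /(rule_vars Pl ymu) zl; rewrite e in St.
  exact: terms_over_subst_inv St zl.
have /terms_over_App[Sf Ss] := St.
apply/terms_over_App; split => // j; rewrite /setarg; case: eqP => // _.
exact: IH s' ymu.
Qed.

Definition leaf (t : T) : Prop := if t is App f _ then ~ Sigma f else True.

Lemma no_root_step ok f (ts : 'I_(ar f) -> T) nu : ~ Sigma f ->
  rewrite_with ok P (App f ts) nu ->
  exists i nu', rewrite_with ok P (ts i) nu' /\
     nu = mmap (fun a => App f (setarg ts i a)) nu'.
Proof.
move=> nSf /rewrite_App[[l [mu [sigma [Pl e _ _]]]]|//]; case: nSf.
have [+ _ _] := hP.2 _ _ Pl; have := rule_lhs_over Pl.
by case: l e {Pl} => //= g ls [fg _] /terms_over_App[Sg _] _; rewrite fg.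
Qed.

Lemma leaf_step s t nu x : leaf t -> step s P t nu -> x \in nu -> leaf x.2.
Proof.
rewrite stepE; case: t => [y _ /rewrite_Var //|f ts /= nSf].
by move=> /(no_root_step nSf)[i [nu' [_ ->]]] /mem_mmap[y _ ->].
Qed.

(** A leaf is a variable or has a foreign root, so a pattern over the symbols of the rules never
    reaches into a leaf. What its variables are bound to is therefore a filled part of [u]. *)
Lemma match_skeleton l sigma u b : terms_over Sigma l -> terms_over Sigma u ->
  (forall n, leaf (b n)) -> subst sigma l = subst b u ->
  forall x, vars l x -> exists w,
    [/\ subst b w = sigma x, terms_over Sigma w & vars w `<=` vars u].
Proof.
move=> + + lb; elim: l u => [y|f ls IH] u Sl Su e x /=; first by move=> ->; exists u; split.
move=> [i xi]; have /terms_over_App[Sf Sls] := Sl.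
case: u Su e => [z _ /= e|g us /terms_over_App[_ Sus] /= e].
  by have := lb z; rewrite -e.
have fg : f = g by case: e.
subst g; have /(congr1 (@^~ i)) ei := App_inj e.
have [w [e1 e2 e3]] := IH i (us i) (Sls i) (Sus i) ei x xi.
by exists w; split => // z /e3; exists i.
Qed.

(** For the same reason an equality of two filled skeletons reduces to equalities between leaves,
    which are all that [theta] has to respect. *)
Lemma skeleton_eq u1 u2 b theta : terms_over Sigma u1 -> terms_over Sigma u2 ->
  (forall n, leaf (b n)) -> subst b u1 = subst b u2 ->
  (forall z z', vars u1 z -> vars u2 z' -> b z = b z' -> theta z = theta z' :> T) ->
  subst theta u1 = subst theta u2.
Proof.
move=> + + lb; elim: u1 u2 => [z|f us IH] [z'|g us'] S1 S2 /= e th; first exact: th.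
- by have := lb z; rewrite e; have /terms_over_App[] := S2.
- by have := lb z'; rewrite -e; have /terms_over_App[] := S1.
have fg : f = g by case: e.
subst g; have e' := App_inj e.
have /terms_over_App[_ S1s] := S1; have /terms_over_App[_ S2s] := S2.
congr App; apply/funext => i; apply: IH => //; first exact: (congr1 (@^~ i) e').
by move=> z z' zi zi'; apply: th; exists i.
Qed.

(** As [tau] merges only variables with equal leaves, some [kappa] turns the renamed skeleton back
    into [subst b w], and an instance being normal makes the term normal. *)
Lemma nf_rename b (tau : nat -> nat) w : nf (subst b w) ->
  (forall z z', vars w z -> vars w z' -> tau z = tau z' -> b z = b z') ->
  nf (subst (fun z => Var (tau z)) w).
Proof.
move=> n inj.
have /choice[kappa kP] : forall k, exists t : T, forall z, vars w z -> tau z = k -> t = b z.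
  move=> k; have [[z zw zk]|nz] := pselect (exists2 z, vars w z & tau z = k).
    by exists (b z) => z' zw' zk'; apply: inj => //; rewrite zk zk'.
  by exists (Var 0) => z zw zk; case: nz; exists z.
apply: (@nf_subst kappa); rewrite subst_comp.
rewrite (@eq_in_subst _ _ _ b) // => z zw /=; exact: kP.
Qed.

(** * Filled skeletons as products of a skeleton and its leaves *)

Section Skeletons.
Variables (s : strategy) (m : nat).
Hypothesis small : s = innermost \/ ((m <= 1)%N /\ forall f, Sigma f -> (ar f <= 1)%N).

Definition compatible (b : nat -> T) : pred {ffun 'I_m -> 'I_m} :=
  fun th => `[< forall z z' : 'I_m, nf (b z) -> nf (b z') ->
    (th z = th z' <-> b z = b z') >].

Definition extend (th : {ffun 'I_m -> 'I_m}) (n : nat) : nat :=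
  if insub n is Some i then val (th i) else n.

Definition rename (th : {ffun 'I_m -> 'I_m}) (u : T) : T :=
  subst (fun z => Var (extend th z)) u.

(** The [sep] clause makes every leaf that can still move occur at most once, so that a step of the
    leaf is a single step of the whole term. *)
Definition skeleton (u : T) (b : nat -> T) : Prop :=
  [/\ terms_over Sigma u, forall z, vars u z -> (z < m)%N,
      sep (fun z => nf (b z)) u & forall n, leaf (b n)].

Lemma extend_ord th (i : 'I_m) : extend th i = th i.
Proof. by rewrite /extend valK. Qed.

Lemma compatible_exists b : exists th, compatible b th.
Proof.
(* The pick depends only on the value [b i], so equal leaves get the same representative. *)
pose th := [ffun i : 'I_m => odflt i [pick j : 'I_m | b j == b i]].
have bth i : b (th i) = b i.
  by rewrite /th ffunE; case: pickP => [j /eqP //|/(_ i)]; rewrite eqxx.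
exists th; apply/asboolP => z z' _ _; split=> [e|e]; first by rewrite -bth e bth.
rewrite /th !ffunE e; case: pickP => [//|/(_ z')]; by rewrite eqxx.
Qed.

(** The leaf that moves is not normal, so all constraints between normal leaves persist; a leaf that
    becomes normal can only add constraints. *)
Lemma compatible_step b z nu x th : step s P (b z) nu -> x \in nu ->
  compatible (upd b z x.2) th -> compatible b th.
Proof.
move=> sz xnu /asboolP c; apply/asboolP => i j ni nj.
have nz k : nf (b k) -> (k == z) = false.
  move=> nk; apply/negP => /eqP kz; rewrite kz in nk; apply: nk; exists nu.
  by move: sz; rewrite stepE => /rewrite_full.
by have := c i j; rewrite /upd !nz //; apply.
Qed.

Lemma skeleton_step b u z nu x : skeleton u b -> step s P (b z) nu -> x \in nu ->
  skeleton u (upd b z x.2).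
Proof.
move=> [Su vu su lb] sz xnu; split => // [|n].
  apply: sep_sub su => k nk; rewrite /upd; case: eqP => // kz; case: nk.
  by rewrite kz; exists nu; move: sz; rewrite stepE => /rewrite_full.
by rewrite /upd; case: eqP => // _; apply: leaf_step (lb z) sz xnu.
Qed.

(** The redex already lies in the skeleton. It survives the renaming because all leaves in an
    innermost redex are normal and thus faithfully represented, while in the other case there is at
    most one variable. *)
Lemma skeleton_root_step f (us : 'I_(ar f) -> T) b l mu0 sigma :
  skeleton (App f us) b -> P (l, mu0) -> subst b (App f us) = subst sigma l ->
  ok_redex s (subst b (App f us)) ->
  exists nu, [/\ inner_step (step s P) compatible rename b (App f us) nu,
      forall x, x \in nu -> skeleton x.2 b /\ vars x.2 `<=` vars (App f us) &
      mmap (subst sigma) mu0 = mmap (subst b) nu].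
Proof.
move=> [Su vu su lb] Pl e ok.
have Sl := rule_lhs_over Pl.
have /choice[rho rhoP] : forall x, exists w, vars l x ->
    [/\ subst b w = sigma x, terms_over Sigma w & vars w `<=` vars (App f us)].
  move=> x; have [xl|nxl] := pselect (vars l x); last by exists (Var 0).
  by have [w wP] := match_skeleton Sl Su lb (esym e) xl; exists w.
have el : subst b (subst rho l) = subst b (App f us).
  by rewrite subst_comp e; apply: eq_in_subst => x /rhoP[].
have Srl : terms_over Sigma (subst rho l).
  by apply: terms_over_subst Sl _ => x /rhoP[].
have nfv : s = innermost -> forall z, vars (App f us) z -> nf (b z).
  move=> es z [i zi]; move: ok; rewrite es => /ok_innermost /(_ i) n.
  exact: nf_subst_var n zi.
have vrho x : vars l x -> vars (rho x) `<=` vars (App f us) by move=> /rhoP[].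
exists (mmap (subst rho) mu0); split; last first.
- rewrite mmap_comp; apply: eq_in_mmap => x xmu /=; rewrite subst_comp.
  by apply: eq_in_subst => z /(rule_vars Pl xmu) /rhoP[].
- move=> x /mem_mmap[y ymu ->] /=.
  have vy : vars (subst rho y.2) `<=` vars (App f us).
    by move=> z /vars_subst[w /(rule_vars Pl ymu) wl]; apply: vrho.
  have Sy : terms_over Sigma (subst rho y.2).
    apply: terms_over_subst; first exact: rule_rhs_over Pl ymu.
    by move=> z /(rule_vars Pl ymu) /rhoP[].
  split => //; split => // [z /vy /vu //|].
  (* Rules may duplicate variables: either all of these stand for normal leaves, or no symbol has
     two arguments. *)
  case: small => [es|[_ S1]]; last exact: sep_unary S1 Sy.
  by apply: sep_vars => z /vy; apply: nfv.
move=> th /asboolP c.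
(* A nonlinear left-hand side still matches, because equal leaves under the redex are sent to equal
   variables. *)
have elr : rename th (subst rho l) = rename th (App f us).
  apply: (skeleton_eq Srl Su lb el) => z z' /vars_subst[w wl /(vrho _ wl) zu] zu' bz.
  congr Var; have zm := vu _ zu; have zm' := vu _ zu'.
  rewrite -[z]/(val (Ordinal zm)) -[z']/(val (Ordinal zm')) !extend_ord; congr val.
  case: small => [es|[m1 _]]; last by congr (th _); apply: ord_le1.
  by apply/c => //; apply: nfv.
rewrite -elr /rename subst_comp mmap_comp stepE.
have -> : subst (fun z => Var (extend th z)) \o subst rho =
    subst (fun x => subst (fun z => Var (extend th z)) (rho x)) :> (T -> T).
  by apply/funext => t; apply: subst_comp.
apply: rewrite_root => //; rewrite -subst_comp -/(rename th _) elr.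
(* In the innermost case the arguments must also stay normal; this uses the converse, that distinct
   normal leaves stay distinct. *)
move: nfv ok; case: s => // /(_ erefl) nfv /ok_innermost ok.
apply/ok_innermost => i; apply: nf_rename (ok i) _ => z z' zi zi'.
have zu : vars (App f us) z by exists i.
have zu' : vars (App f us) z' by exists i.
have zm := vu _ zu; have zm' := vu _ zu'.
rewrite -[z]/(val (Ordinal zm)) -[z']/(val (Ordinal zm')) !extend_ord => /val_inj eth.
by apply/c => //; apply: nfv.
Qed.

Lemma skeleton_decompose u b mu : skeleton u b -> step s P (subst b u) mu ->
  (exists nu, [/\ inner_step (step s P) compatible rename b u nu,
      forall x, x \in nu -> skeleton x.2 b /\ vars x.2 `<=` vars u &
      mu = mmap (subst b) nu]) \/
  (exists z nu, [/\ vars u z, step s P (b z) nu &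
      mu = mmap (fun a => subst (upd b z a) u) nu]).
Proof.
elim: u mu => [z|f us IH] mu sk st.
  right; exists z, mu; split => //; rewrite -[LHS]map_id; apply: eq_map => -[p a] /=.
  by rewrite /upd eqxx.
move: (st); rewrite {1}stepE /= => /rewrite_App[[l [mu0 [sigma [Pl e ok ->]]]]|[i [nu' [s' ->]]]].
  by left; apply: skeleton_root_step sk Pl e ok.
have [Su vu [su1 su2] lb] := sk; have /terms_over_App[Sf Sus] := Su.
have ski : skeleton (us i) b by split => // [z zi|]; [apply: vu; exists i|exact: su1].
rewrite -stepE in s'.
case: (IH i _ ski s') => [[nu [inu gnu ->]]|[z [nu [zi sz ->]]]]; last first.
  right; exists z, nu; split => //; first by exists i.
  rewrite mmap_comp; congr mmap; apply/funext => a /=; congr App; apply/funext => j.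
  (* The moving leaf [z] is not normal, so by [sep] it does not occur in the other arguments. *)
  rewrite /setarg; case: eqP => [->//|ji]; apply: eq_in_subst => k kj.
  rewrite /upd; case: eqP => // kz; rewrite kz in kj.
  case: (su2 _ _ _ kj zi ji); exists nu; by move: sz; rewrite stepE => /rewrite_full.
left; exists (mmap (fun w => App f (setarg us i w)) nu); split.
- move=> th cth; have := inu th cth; rewrite !stepE => /(@rewrite_arg _ f (fun i => rename th (us i))).
  rewrite !mmap_comp; congr (rewrite_with _ P _ (mmap _ _)).
  apply/funext => a /=; rewrite /rename /=; congr App; apply/funext => j.
  by rewrite /setarg; case: eqP.
- move=> x /mem_mmap[y ynu ->] /=; have [[Sy vy sy _] vyi] := gnu _ ynu.
  have vx : vars (App f (setarg us i y.2)) `<=` vars (App f us).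
    by move=> z [j]; rewrite /setarg; case: eqP => [_ /vyi|_] zj; [exists i|exists j].
  split => //; split => // [|z /vx /vu //|].
    by apply/terms_over_App; split => // j; rewrite /setarg; case: eqP.
  split=> [j|j k z]; rewrite /setarg; first by case: eqP => // _; apply: su1.
  case: eqP => [->|ji]; case: eqP => [->|ki] // zj zk jk.
  + by apply: (su2 i k) => //; apply: vyi.
  + by apply: (su2 j i) => //; apply: vyi.
  + exact: (su2 j k).
- rewrite !mmap_comp; congr mmap; apply/funext => a /=; congr App; apply/funext => j.
  by rewrite /setarg; case: eqP.
Qed.

Lemma product_closed_skeleton K u b : product_closed (step s P) K ->
  (forall t, terms_over Sigma t -> K t) -> skeleton u b -> (forall z, K (b z)) ->
  K (subst b u).
Proof.
move=> pK KS; apply: (pK T _ m (fun u b => subst b u) skeleton compatible rename).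
- exact: compatible_exists.
- exact: compatible_step.
- exact: skeleton_step.
- move=> {}u {}b mu sk st.
  have [[nu [inu gnu e]]|[z [nu [zu sz e]]]] := skeleton_decompose sk st.
    by left; exists nu; split => // x /gnu[].
  by right; exists z, nu; split => //; have [_ vu _ _] := sk; apply: vu.
- by move=> th {}u {}b [Su _ _ _]; apply: KS; apply: terms_over_subst => // x _; exact: terms_over_Var.
Qed.

End Skeletons.

(** * Terms with a foreign root, and decomposition of terms into skeletons and leaves *)

Lemma product_closed_new_symbol s K f (ts : 'I_(ar f) -> T) :
  product_closed (step s P) K -> (forall x, K (Var x)) -> ~ Sigma f ->
  (forall i, K (ts i)) -> K (App f ts).
Proof.
move=> pK KV nSf Kts.
pose b n := if insub n is Some i then ts i else Var 0.
have -> : ts = fun i => b (val i) by apply/funext => i; rewrite /b valK.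
(* The skeleton is the bare [f], which never makes a step and is represented by a variable; the
   components are the arguments. *)
apply: (pK unit unit (ar f) (fun _ b => App f (fun i => b (val i))) (fun _ _ => True)
   (fun _ _ => true) (fun _ _ => Var 0)) => //.
  move=> u {}b mu _; rewrite stepE => /(no_root_step nSf)[i [nu [sn ->]]].
  right; exists (val i), nu; split; [exact: ltn_ord|exact: sn|].
  by congr mmap; apply/funext => a; congr App; apply/funext => j.
by move=> z; rewrite /b; case: insubP.
Qed.

(** Tagging variables with the argument index through [pickle] keeps the variables of different
    arguments apart, so the skeleton is linear. *)
Lemma skeleton_exists f (ts : 'I_(ar f) -> T) (K : T -> Prop) : Sigma f -> K (Var 0) ->
  (forall i, exists u b, [/\ subst b u = ts i, terms_over Sigma u, sep (fun=> False) u,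
     forall n, leaf (b n) & forall n, K (b n)]) ->
  exists u b, [/\ subst b u = App f ts, terms_over Sigma u, sep (fun=> False) u,
     forall n, leaf (b n) & forall n, K (b n)].
Proof.
move=> Sf KV /choice[u /choice[b ub]].
pose B n := if unpickle n is Some (i, z) then (if insub i is Some j then b j z else Var 0)
  else Var 0 : T.
pose g (i : 'I_(ar f)) (z : nat) := pickle (val i, z).
have Bg i z : B (g i z) = b i z by rewrite /B /g pickleK /= valK.
have ginj i : injective (g i) by move=> x y /(pcan_inj pickleK)[].
exists (App f (fun i => subst (fun z => Var (g i z)) (u i))), B; split => //=.
- congr App; apply/funext => i; rewrite subst_comp /=; have [<- _ _ _ _] := ub i.
  by apply: eq_in_subst => z _; rewrite Bg.
- apply/terms_over_App; split => // i; by apply: terms_over_subst => [|x _]; [have [] := ub i|exact: terms_over_Var].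
- split=> [i|i j z]; first by apply: sep_rename; [exact: ginj|have [] := ub i].
  move=> /vars_subst[x _ ->] /vars_subst[y _] /= /(pcan_inj pickleK)[/val_inj].
  by move=> ->.
- move=> n; rewrite /B; case: unpickle => [[i z]|//]; case: insubP => // j _ _.
  by have [_ _ _ + _] := ub j; apply.
- move=> n; rewrite /B; case: unpickle => [[i z]|//]; case: insubP => // j _ _.
  by have [_ _ _ _ +] := ub j; apply.
Qed.

Lemma skeleton1_exists f (ts : 'I_(ar f) -> T) (K : T -> Prop) : Sigma f ->
  (ar f <= 1)%N -> K (Var 0) ->
  (forall i, exists u b, [/\ subst b u = ts i, terms_over Sigma u,
     forall z, vars u z -> (z < 1)%N, forall n, leaf (b n) & forall n, K (b n)]) ->
  exists u b, [/\ subst b u = App f ts, terms_over Sigma u,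
     forall z, vars u z -> (z < 1)%N, forall n, leaf (b n) & forall n, K (b n)].
Proof.
move=> Sf f1 KV /choice[u /choice[b ub]].
have [i0 _|no] := pickP (fun _ : 'I_(ar f) => true).
  exists (App f u), (b i0); have [e Su v1 lb Kb] := ub i0; split => //=.
  - by congr App; apply/funext => i; rewrite (ord_le1 i i0 f1).
  - by apply/terms_over_App; split => // i; rewrite (ord_le1 i i0 f1).
  - by move=> z [i]; rewrite (ord_le1 i i0 f1); apply: v1.
exists (App f ts), (fun=> Var 0); split => //=.
- by congr App; apply/funext => i; have := no i.
- by apply/terms_over_App; split => // i; have := no i.
- by move=> z [i]; have := no i.
Qed.

(** * Encoding of foreign symbols for full rewriting *)

Section Encoding.
Variable c : F.
Hypotheses (Sc : Sigma c) (c2 : (1 < ar c)%N).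

Definition pair_term (t u : T) : T :=
  App c (fun j => if val j == 0%N then t else if val j == 1%N then u else Var 0).

(** A foreign symbol is forgotten and its arguments are kept as a list built from [c]. New redexes
    may arise, which is harmless for full rewriting, where only the preservation of steps
    matters. *)
Fixpoint enc (t : T) : T :=
  match t with
  | Var x => Var x
  | App f ts => if `[< Sigma f >] then App f (fun i => enc (ts i))
      else foldr (fun i => pair_term (enc (ts i))) (Var 0) (enum 'I_(ar f))
  end.

Lemma enc_over t : terms_over Sigma (enc t).
Proof.
elim: t => [x|f ts IH] /=; first exact: terms_over_Var.
case: asboolP => Sf; first by apply/terms_over_App; split.
elim: (enum _) => [|i r IHr] /=; first exact: terms_over_Var.
apply/terms_over_App; split => // j.
by case: ifP => // _; case: ifP => // _; exact: terms_over_Var.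
Qed.

Lemma enc_subst sigma l : terms_over Sigma l ->
  enc (subst sigma l) = subst (fun x => enc (sigma x)) l.
Proof.
elim: l => //= f ls IH /terms_over_App[Sf Sls]; rewrite asboolT //.
by congr App; apply/funext => i; apply: IH.
Qed.

Lemma pair_term_stepl t u nu : full_step P t nu ->
  full_step P (pair_term t u) (mmap (pair_term^~ u) nu).
Proof.
move=> st.
pose ts (j : 'I_(ar c)) := if val j == 0%N then t else if val j == 1%N then u else Var 0.
have := @rewrite_arg _ c ts (Ordinal (ltnW c2)) nu st.
congr (full_step P _ (mmap _ _)); apply/funext => a; congr App; apply/funext => j.
by rewrite /setarg /ts -val_eqE /=; case: eqP.
Qed.

Lemma pair_term_stepr t u nu : full_step P u nu ->
  full_step P (pair_term t u) (mmap (pair_term t) nu).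
Proof.
move=> st.
pose ts (j : 'I_(ar c)) := if val j == 0%N then t else if val j == 1%N then u else Var 0.
have := @rewrite_arg _ c ts (Ordinal c2) nu st.
congr (full_step P _ (mmap _ _)); apply/funext => a; congr App; apply/funext => j.
by rewrite /setarg /ts -val_eqE /=; case: eqP => [->|] //; case: eqP.
Qed.

Lemma enc_step t nu : full_step P t nu -> full_step P (enc t) (mmap enc nu).
Proof.
elim: t nu => [x|f ts IH] nu; first by move=> /rewrite_Var.
case/rewrite_App => [[l [mu [sigma [Pl e _ ->]]]]|[i [nu' [/IH st ->]]]].
  have Sl := rule_lhs_over Pl; rewrite e enc_subst // mmap_comp.
  rewrite (@eq_in_mmap _ _ _ _ (subst (fun x => enc (sigma x)))); first exact: rewrite_root.
  by move=> x xmu /=; rewrite enc_subst //; apply: rule_rhs_over Pl xmu.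
rewrite mmap_comp /comp /=; case: asboolP => Sf.
  have := @rewrite_arg _ f (fun i => enc (ts i)) i _ st; rewrite mmap_comp.
  congr (full_step P _ (mmap _ _)); apply/funext => a /=; congr App; apply/funext => j.
  by rewrite /setarg; case: eqP.
have : i \in enum 'I_(ar f) by rewrite mem_enum.
have := enum_uniq 'I_(ar f).
have same a r : i \notin r -> foldr (fun j => pair_term (enc (setarg ts i a j))) (Var 0) r
    = foldr (fun j => pair_term (enc (ts j))) (Var 0) r.
  elim: r => //= j r IHr; rewrite inE negb_or => /andP[ij /IHr ->].
  by rewrite /setarg eq_sym (negbTE ij).
(* The moving argument occurs exactly once in the list: its step is taken on the left of the pair at
   its place, and on the right before. *)
elim: (enum _) => //= j r IHr /andP[jr ur]; rewrite inE => /orP[/eqP ij|ir].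
  have := pair_term_stepl (foldr (fun j => pair_term (enc (ts j))) (Var 0) r) st.
  rewrite mmap_comp -ij; congr (full_step P _ (mmap _ _)); apply/funext => a /=.
  by rewrite same ?ij // /setarg eqxx.
have := pair_term_stepr (enc (ts j)) (IHr ur ir); rewrite mmap_comp.
congr (full_step P _ (mmap _ _)); apply/funext => a /=.
by rewrite {2}/setarg; case: eqP => // ji; rewrite ji ir in jr.
Qed.

(** A degenerate product without components: the term itself is the skeleton, simulated by its
    encoding. *)
Lemma product_closed_enc K t : product_closed (step full P) K ->
  (forall t, terms_over Sigma t -> K t) -> K t.
Proof.
move=> pK KS.
apply: (pK T unit 0%N (fun u _ => u) (fun _ _ => True) (fun _ _ => true) (fun _ => enc)
  _ _ _ _ _ t (fun=> Var 0)) => //.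
- move=> u b mu _ st; left; exists mu; split => //.
    by move=> _ _; apply: enc_step.
  by rewrite -[LHS]map_id; apply: eq_map => -[].
- by move=> th u b _; apply: KS; exact: enc_over.
- by move=> z; apply: KS; exact: terms_over_Var.
Qed.

End Encoding.

Lemma product_closed_all s K : product_closed (step s P) K ->
  (forall t, terms_over Sigma t -> K t) -> forall t, K t.
Proof.
move=> pK KS.
have KV x : K (Var x) by apply: KS; exact: terms_over_Var.
have small_or : s = innermost \/ (forall f, Sigma f -> (ar f <= 1)%N) \/
    (s = full /\ exists2 c, Sigma c & (1 < ar c)%N).
  case: (s); last by left.
  right; have [[c Sc c2]|no] := pselect (exists2 c, Sigma c & (1 < ar c)%N).
    by right; split => //; exists c.
  by left => f Sf; rewrite leqNgt; apply/negP => f2; apply: no; exists f.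
case: small_or => [es|[S1|[es [c Sc c2]]]]; last first.
- by move=> t; rewrite es in pK; apply: product_closed_enc Sc c2 _ _ pK KS.
(* The induction also carries a decomposition with leaves in [K], as a term with a rule symbol at
   the root is treated as one filled skeleton. With unary symbols one variable suffices. *)
- move=> t; suff [] : K t /\ exists u b, [/\ subst b u = t, terms_over Sigma u,
     forall z, vars u z -> (z < 1)%N, forall n, leaf (b n) & forall n, K (b n)] by [].
  elim: t => [x|f ts IH].
    by split => //; exists (Var 0), (fun=> Var x); split => // z ->.
  have [Sf|nSf] := pselect (Sigma f).
    suff h : exists u b, [/\ subst b u = App f ts, terms_over Sigma u,
      forall z, vars u z -> (z < 1)%N, forall n, leaf (b n) & forall n, K (b n)].
      split => //; have [u [b [<- Su v1 lb Kb]]] := h.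
      have small : s = innermost \/ (1 <= 1)%N /\ forall f, Sigma f -> (ar f <= 1)%N by right.
      apply: (product_closed_skeleton small) => //; split => //.
      exact: sep_unary Su.
    by apply: skeleton1_exists => // [|i]; [exact: S1|have [] := IH i].
  have Kt : K (App f ts).
    by apply: product_closed_new_symbol pK KV nSf _ => i; have [] := IH i.
  by split => //; exists (Var 0), (fun=> App f ts); split => // z ->.
- move=> t; suff [] : K t /\ exists u b, [/\ subst b u = t, terms_over Sigma u,
     sep (fun=> False) u, forall n, leaf (b n) & forall n, K (b n)] by [].
  elim: t => [x|f ts IH].
    by split => //; exists (Var 0), (fun=> Var x); split.
  have [Sf|nSf] := pselect (Sigma f).
    suff h : exists u b, [/\ subst b u = App f ts, terms_over Sigma u,
      sep (fun=> False) u, forall n, leaf (b n) & forall n, K (b n)].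
      split => //; have [u [b [<- Su su lb Kb]]] := h.
      have [m vm] := vars_bound u.
      have small : s = innermost \/ (m <= 1)%N /\ forall f, Sigma f -> (ar f <= 1)%N by left.
      apply: (product_closed_skeleton small) => //; split => //.
      exact: sep_sub su.
    by apply: skeleton_exists => // i; have [] := IH i.
  have Kt : K (App f ts).
    by apply: product_closed_new_symbol pK KV nSf _ => i; have [] := IH i.
  (* A term with a foreign root becomes a leaf itself, now that [K] is known for it. *)
  by split => //; exists (Var 0), (fun=> App f ts); split.
Qed.

End Rewriting.

(** * Restriction to smaller signatures, and the equivalences *)

Lemma AST_subset (R : realType) (A : eqType) (D D' : set A)
    (to : A -> multidist R A -> Prop) : D `<=` D' -> AST D' to -> AST D to.
Proof.
move=> DD' ast mu [dmu l]; apply: ast; split => // n.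
by have [p01 p1 Dn] := dmu n; split => // x /Dn /DD'.
Qed.

Lemma SAST_subset (R : realType) (A : eqType) (D D' : set A)
    (to : A -> multidist R A -> Prop) : D `<=` D' -> SAST D' to -> SAST D to.
Proof.
move=> DD' sast a Da; apply: le_lt_trans (sast a (DD' _ Da)).
apply: ereal_sup_le => _ [mu [[dmu l] mu0] <-].
exists mu => //; split => //; split => // n.
by have [p01 p1 Dn] := dmu n; split => // x /Dn /DD'.
Qed.

Theorem theorem7p15 (R : realType) (F : Type) (ar : F -> nat)
    (P : set (rule R ar)) (hP : is_PTRS P) (s : strategy) (Sigma' : set F) :
  (AST (terms_over (sig_of P)) (step s P) <->
   AST (terms_over (sig_of P `|` Sigma')) (step s P)) /\
  (SAST (terms_over (sig_of P)) (step s P) <->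
   SAST (terms_over (sig_of P `|` Sigma')) (step s P)).
Proof.
have sub : terms_over (ar := ar) (sig_of P) `<=` terms_over (sig_of P `|` Sigma').
  by move=> t St g /St; left.
have d := @step_FDist _ _ _ _ hP s.
have cS := @step_closed_over _ _ _ _ hP s.
split; split; [|exact: AST_subset sub| |exact: SAST_subset sub] => h.
(* The certificates extend from terms over the symbols of the rules to all terms. *)
- apply: (ast_at_AST d) => t _.
  apply: (product_closed_all hP (product_closed_ast_at d)) => u Su.
  exact (AST_ast_at d cS h Su).
- apply: sast_at_SAST => t _.
  apply: (product_closed_all hP (product_closed_sast_at d)) => u Su.
  exact (SAST_sast_at d cS h Su).
Qed.
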